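(* There is a polynomial-time algorithm that, for every irreducible non-mortal finite family $\mathcal A=\{A_1,\dots,A_m\}$ of $d\times d$ matrices with integer entries, decides whether $\mathcal A$ generates a finite (multiplicative) semigroup.
   Context: A family of $d\times d$ matrices is irreducible if there is no proper linear subspace of $\mathbb R^d$ (different from $\{0\}$ and $\mathbb R^d$) invariant for all its matrices. A family is non-mortal if none of the finite products (with repetitions permitted) of its matrices is the zero matrix. Polynomial time means polynomial in the size of the input. *)

(* Defs.v *)
From HB Require Import structures.
From mathcomp Require Import all_boot all_order all_algebra.
From mathcomp Require Import boolp classical_sets cardinality reals.

Set Implicit Arguments.
Unset Strict Implicit.
Unset Printing Implicit Defensive.

Import GRing.Theory.
Local Open Scope ring_scope.

(** * Random access machines with the logarithmic cost criterion

  The machine is that of Aho, Hopcroft and Ullman, in three-address form: a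
  fixed finite program, a read-only input tape of integers, and a memory of
  registers indexed by the natural numbers, each holding an integer of
  arbitrary size.  Under the logarithmic cost criterion every instruction is
  charged the binary length of all the addresses and operands that it handles,
  so that time is polynomially related to Turing machine time. *)

Variant arith := Plus | Minus | Times | Quotient.

Variant instr :=
  | Const of nat & int              (* r <- c *)
  | Op of arith & nat & nat & nat   (* r <- s op t *)
  | LoadInd of nat & nat            (* r <- register whose address is in s *)
  | StoreInd of nat & nat           (* register whose address is in r <- s *)
  | Read of nat                     (* r <- next integer of the input *)
  | Jump of nat                     (* go to instruction l *)
  | JumpPos of nat & nat            (* go to instruction l if s > 0 *)
  | Halt.

Definition program := seq instr.

Record config := Config {
  pc : nat;
  mem : nat -> int;
  tape : seq int
}.

(* Binary length of |z|; 0 has length 1. *)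
Definition bitlen (z : int) : nat := (trunc_log 2 `|z|%N).+1.

(* Quotient is Euclidean division, with result 0 when the divisor is 0. *)
Definition eval_arith (o : arith) (x y : int) : int :=
  match o with
  | Plus => x + y
  | Minus => x - y
  | Times => x * y
  | Quotient => (x %/ y)%Z
  end.

Definition update (M : nat -> int) (r : nat) (v : int) : nat -> int :=
  fun a => if a == r then v else M a.

(* Indirect addressing ignores the sign of the address; reading past the end of
   the input yields 0. *)
Definition step (i : instr) (c : config) : config :=
  let: Config l M w := c in
  match i with
  | Const r z => Config l.+1 (update M r z) w
  | Op o r s t => Config l.+1 (update M r (eval_arith o (M s) (M t))) w
  | LoadInd r s => Config l.+1 (update M r (M `|M s|%N)) w
  | StoreInd r s => Config l.+1 (update M `|M r|%N (M s)) w
  | Read r => Config l.+1 (update M r (head 0 w)) (behead w)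
  | Jump l' => Config l' M w
  | JumpPos s l' => Config (if 0 < M s then l' else l.+1) M w
  | Halt => c
  end.

Definition cost (i : instr) (c : config) : nat :=
  let M := mem c in
  match i with
  | Const r z => bitlen r + bitlen z
  | Op _ r s t =>
      bitlen r + bitlen s + bitlen t + bitlen (M s) + bitlen (M t)
  | LoadInd r s => bitlen r + bitlen s + bitlen (M s) + bitlen (M `|M s|%N)
  | StoreInd r s => bitlen r + bitlen s + bitlen (M r) + bitlen (M s)
  | Read r => bitlen r + bitlen (head 0%R (tape c))
  | Jump _ => 1
  | JumpPos s _ => bitlen s + bitlen (M s)
  | Halt => 1
  end%N.

(* Leaving the program amounts to halting. *)
Definition fetch (P : program) (c : config) : instr := nth Halt P (pc c).

(* [halts P c t b]: started in configuration c, P halts after total cost t with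
   answer b, which is "yes" iff register 0 is then nonzero. *)
Inductive halts (P : program) (c : config) : nat -> bool -> Prop :=
  | halts_now : fetch P c = Halt -> halts P c 1 (mem c 0%N != 0)
  | halts_step t b :
      fetch P c <> Halt -> halts P (step (fetch P c) c) t b ->
      halts P c (cost (fetch P c) c + t)%N b.

Definition initial (w : seq int) : config := Config 0 (fun=> 0) w.

(** * Finite families of integer matrices *)

Section Families.
Variables (d m : nat) (A : 'I_m -> 'M[int]_d).

(* The two dimensions, followed by the entries of A_1, ..., A_m, each matrix
   being listed row by row. *)
Definition encode : seq int :=
  d%:Z :: m%:Z ::
  flatten [seq [seq A k i j | i <- enum 'I_d, j <- enum 'I_d] | k <- enum 'I_m].

Definition input_size : nat := (\sum_(z <- encode) bitlen z)%N.

Definition irreducible (R : realType) : Prop :=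
  forall W : {vspace 'cV[R]_d},
    (forall (k : 'I_m) (v : 'cV[R]_d),
       v \in W -> map_mx intr (A k) *m v \in W) ->
    W = 0%VS \/ W = fullv.

Definition word_product (s : seq 'I_m) : 'M[int]_d := \prod_(k <- s) A k.

Definition non_mortal : Prop :=
  forall s : seq 'I_m, s <> [::] -> word_product s <> 0.

Definition generated_semigroup : set 'M[int]_d :=
  [set B | exists2 s : seq 'I_m, s <> [::] & B = word_product s]%classic.

End Families.

(* Main.v *)
Require Import Defs.
From HB Require Import structures.
From mathcomp Require Import all_boot all_order all_algebra all_field.
From mathcomp Require Import boolp classical_sets cardinality reals.
From mathcomp Require Import ring lra zify.

Set Implicit Arguments.
Unset Strict Implicit.
Unset Printing Implicit Defensive.

Import Order.TTheory GRing.Theory Num.Theory.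
Local Open Scope ring_scope.

(** Let [Phi X = sum_k A_k^T X A_k] act on [d x d] matrices; its matrix is the
  sum [kron A] of the Kronecker squares of the [A_k].  For an irreducible
  non-mortal integer family the semigroup is finite iff all the coefficients of
  [chi = char_poly (kron A - m)] are nonnegative.

  If the semigroup is finite, the iterates of [Phi] grow at most like [m ^ n],
  so that every eigenvalue of [kron A] has modulus at most [m] and the roots of
  [chi] lie in the closed left half-plane; a real monic polynomial with this
  property has nonnegative coefficients.

  Conversely, if they are nonnegative then [chi] is positive on the positive
  axis, hence [(t + m - Phi)^-1 (1)] exists for all [t > 0].  It is positive
  semidefinite for large [t], and stays so as [t] decreases to 0 because
  [(t + m) X = 1 + Phi X].  The lowest-order coefficient at [t = 0] of
  [chi (t) (t + m - Phi)^-1 (1)] is a nonzero positive semidefinite form [Z] with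
  [Phi Z <= m Z].  Its kernel is an invariant subspace, so [Z] is definite.
  Among the integer matrices [B] of the semigroup the energy, the sum of the
  values of [Z] on the columns of [B], has a minimum, and there the averaging
  inequality forces the energy to be constant on the left orbit of [B].  Hence
  this orbit is bounded; the vectors with bounded orbit form an invariant
  subspace, containing the image of [B], which is nonzero by non-mortality.  So
  the semigroup is bounded, hence finite.

  Up to positive factors, the coefficients of [chi] are computed without division
  by the Faddeev-LeVerrier recurrence, on integers of polynomial size. *)

(** * A structured language and its compilation to the machine *)

Inductive expr :=
  | Lit of int
  | Var of nat
  | Arr of nat & expr
  | Bin of arith & expr & expr.

Inductive cmd :=
  | Assign of nat & expr
  | Store of nat & expr & expr
  | Input of nat
  | Seq of cmd & cmd
  | For of nat & nat & cmd.

Record state := St {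
  vars : seq int;
  arrs : seq (nat -> int);
  inp : seq int
}.

Definition getv (s : state) x := nth 0 (vars s) x.
Definition geta (s : state) a i := nth (fun=> 0) (arrs s) a i.
Definition setv (s : state) x v :=
  St (set_nth 0 (vars s) x v) (arrs s) (inp s).
Definition seta (s : state) a i v :=
  St (vars s)
     (set_nth (fun=> 0) (arrs s) a (fun j => if j == i then v else geta s a j))
     (inp s).

Fixpoint eval (s : state) (e : expr) : int :=
  match e with
  | Lit c => c
  | Var x => getv s x
  | Arr a e => geta s a `|eval s e|%N
  | Bin o e1 e2 => eval_arith o (eval s e1) (eval s e2)
  end.

(* Variables, scratch registers and arrays live in distinct residue classes
   modulo 8, so that no two of them ever overlap. *)
Definition var x := (8 * x)%N.
Definition tmp r := (8 * r + 1)%N.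
Definition cell a i := (8 * i + (a + 2))%N.

Arguments var : simpl never.
Arguments tmp : simpl never.
Arguments cell : simpl never.

Definition compile_addr r a : seq instr :=
  [:: Const (tmp r.+1) 8; Op Times (tmp r) (tmp r) (tmp r.+1);
      Const (tmp r.+1) (a + 2)%N%:Z; Op Plus (tmp r) (tmp r) (tmp r.+1)].

(** The result goes to [tmp r] and the registers [tmp r'] with [r' < r] are preserved, so that the
    temporaries act as an evaluation stack. A variable is copied by adding it to 0. *)
Fixpoint compile_expr r (e : expr) : seq instr :=
  match e with
  | Lit c => [:: Const (tmp r) c]
  | Var x => [:: Const (tmp r) 0; Op Plus (tmp r) (tmp r) (var x)]
  | Arr a e =>
      compile_expr r e ++ compile_addr r a ++ [:: LoadInd (tmp r) (tmp r)]
  | Bin o e1 e2 =>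
      compile_expr r e1 ++ compile_expr r.+1 e2 ++
      [:: Op o (tmp r) (tmp r) (tmp r.+1)]
  end.

(** Jumps are absolute, hence the offset. A loop has four instructions before its body and three
    after it; its test starts at [off.+1], after the initialisation at [off]. *)
Fixpoint compile off (c : cmd) : seq instr :=
  match c with
  | Assign x e =>
      compile_expr 0 e ++
      [:: Const (tmp 1) 0; Op Plus (var x) (tmp 0) (tmp 1)]
  | Store a e1 e2 =>
      compile_expr 0 e2 ++ compile_expr 1 e1 ++ compile_addr 1 a ++
      [:: StoreInd (tmp 1) (tmp 0)]
  | Input x => [:: Read (var x)]
  | Seq c1 c2 =>
      let p1 := compile off c1 in p1 ++ compile (off + size p1) c2
  | For x n c =>
      let p := compile (off + 4) c in
      [:: Const (var x) 0; Op Minus (tmp 0) (var n) (var x);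
          JumpPos (tmp 0) (off + 4); Jump (off + 7 + size p)] ++ p ++
      [:: Const (tmp 0) 1; Op Plus (var x) (var x) (tmp 0); Jump off.+1]
  end.

(* Static bounds, which make all the register numbers and constants occurring
   in the code smaller than 2 ^ 8. *)
Fixpoint small_expr r (e : expr) : bool :=
  match e with
  | Lit c => (r < 16)%N && (`|c| < 256)%N
  | Var x => (r < 16)%N && (x < 16)%N
  | Arr a e => [&& small_expr r e, (r < 16)%N & (a < 6)%N]
  | Bin _ e1 e2 => [&& small_expr r e1, small_expr r.+1 e2 & (r < 16)%N]
  end.

(** Apart from literals, which [small_expr] controls, every intermediate value stays below [2 ^ B].
    So does the address of an array access, since [cell a i < 8 * i + 8] when [a < 6]. *)
Fixpoint bounded B (s : state) (e : expr) : Prop :=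
  match e with
  | Lit _ => True
  | Var x => (`|getv s x| < 2 ^ B)%N
  | Arr a e =>
      [/\ bounded B s e, 0 <= eval s e, (8 * `|eval s e| + 8 < 2 ^ B)%N
        & (`|geta s a `|eval s e|%N| < 2 ^ B)%N]
  | Bin o e1 e2 =>
      [/\ bounded B s e1, bounded B s e2
        & (`|eval_arith o (eval s e1) (eval s e2)| < 2 ^ B)%N]
  end.

Definition code_at (P : program) off (p : seq instr) :=
  forall i, (i < size p)%N -> nth Halt P (off + i) = nth Halt p i.

Lemma code_at_cat P off p1 p2 :
  code_at P off (p1 ++ p2) -> code_at P off p1 /\ code_at P (off + size p1) p2.
Proof.
move=> h; split=> i lti.
  by rewrite h ?nth_cat ?lti // size_cat ltn_addr.
by rewrite -addnA h ?size_cat ?ltn_add2l // nth_cat ltnNge leq_addr /= addKn.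
Qed.

Inductive reach (P : program) : config -> config -> nat -> Prop :=
  | reach_refl c : reach P c c 0
  | reach_step c c' t :
      fetch P c <> Halt -> reach P (step (fetch P c) c) c' t ->
      reach P c c' (cost (fetch P c) c + t)%N.

Lemma reach_trans P c1 c2 c3 t1 t2 :
  reach P c1 c2 t1 -> reach P c2 c3 t2 -> reach P c1 c3 (t1 + t2).
Proof.
move=> h; elim: h c3 t2 => [c|c c' t nH _ IH] c3 t2 h2; first by rewrite add0n.
by rewrite -addnA; apply: reach_step => //; apply: IH.
Qed.

Lemma reach_halts P c c' t :
  reach P c c' t -> fetch P c' = Halt -> halts P c (t + 1) (Defs.mem c' 0%N != 0).
Proof.
elim=> [x|x x' u nH _ IH] h; first exact: halts_now.
by rewrite -addnA; apply: halts_step => //; apply: IH.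
Qed.

Lemma bitlen_le B z : (0 < B)%N -> (`|z| < 2 ^ B)%N -> (bitlen z <= B)%N.
Proof.
rewrite /bitlen => B0 zB; have [->|z0] := posnP `|z|%N; first by rewrite trunc_log0.
by rewrite -(ltn_exp2l _ _ (ltnSn 1)) (leq_ltn_trans _ zB) // trunc_logP.
Qed.

(** An instruction handles at most five quantities, each of at most [B] bits: hence the cost [5 * B]
    per instruction. *)
Definition block B P off (p : seq instr) M w M' w' :=
  code_at P off p ->
  exists2 t, reach P (Config off M w) (Config (off + size p) M' w') t
           & (t <= size p * (5 * B))%N.

Lemma block_cat B P off p1 p2 M w M1 w1 M2 w2 :
  block B P off p1 M w M1 w1 -> block B P (off + size p1) p2 M1 w1 M2 w2 ->
  block B P off (p1 ++ p2) M w M2 w2.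
Proof.
move=> h1 h2 /code_at_cat [/h1 [t ht tB] /h2 [u hu uB]].
exists (t + u)%N; last by rewrite size_cat mulnDl leq_add.
by rewrite size_cat addnA; apply: reach_trans hu.
Qed.

Lemma block_one B P off i M w M' w' :
  i <> Halt -> step i (Config off M w) = Config off.+1 M' w' ->
  (cost i (Config off M w) <= 5 * B)%N ->
  block B P off [:: i] M w M' w'.
Proof.
move=> nH hs hc /(_ 0%N isT) h; rewrite addn0 /= in h.
have fE : fetch P (Config off M w) = i by [].
exists (cost i (Config off M w) + 0)%N; last by rewrite addn0 mul1n.
have := @reach_step P (Config off M w) (Config off.+1 M' w') 0.
by rewrite addn1 fE hs; apply=> //; apply: reach_refl.
Qed.

Lemma block_cons B P off i p M w M1 w1 M2 w2 :
  i <> Halt -> step i (Config off M w) = Config off.+1 M1 w1 ->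
  (cost i (Config off M w) <= 5 * B)%N ->
  block B P off.+1 p M1 w1 M2 w2 ->
  block B P off (i :: p) M w M2 w2.
Proof.
move=> nH hs hc h; rewrite -cat1s; apply: block_cat (block_one nH hs hc) _.
by rewrite addn1.
Qed.

(** The temporaries are left free, so that scratch work never affects the represented state. *)
Definition rep (s : state) (M : nat -> int) (w : seq int) :=
  [/\ forall x, M (var x) = getv s x,
      forall a i, (a < 6)%N -> M (cell a i) = geta s a i
    & w = inp s].

Lemma var_inj x y : (var x == var y) = (x == y).
Proof. by rewrite /var; lia. Qed.

Lemma tmp_inj x y : (tmp x == tmp y) = (x == y).
Proof. by rewrite /tmp; lia. Qed.

Lemma var_tmp x r : (var x == tmp r) = false.
Proof. by rewrite /var /tmp; lia. Qed.

Lemma cell_tmp a i r : (a < 6)%N -> (cell a i == tmp r) = false.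
Proof. by rewrite /cell /tmp; lia. Qed.

Lemma cell_var a i x : (a < 6)%N -> (cell a i == var x) = false.
Proof. by rewrite /cell /var; lia. Qed.

Lemma var_cell a i x : (a < 6)%N -> (var x == cell a i) = false.
Proof. by rewrite /cell /var; lia. Qed.

Lemma cell_inj a i b j : (a < 6)%N -> (b < 6)%N ->
  (cell a i == cell b j) = (a == b) && (i == j).
Proof. by rewrite /cell; lia. Qed.

Lemma rep_tmp s M w r v : rep s M w -> rep s (update M (tmp r) v) w.
Proof.
case=> hv ha hw; split=> // [x|a i a6]; rewrite /update.
  by rewrite var_tmp.
by rewrite cell_tmp // ha.
Qed.

Lemma rep_setv s M w x v : rep s M w -> rep (setv s x v) (update M (var x) v) w.
Proof.
case=> hv ha hw; split=> // [y|a i a6]; rewrite /update.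
  by rewrite var_inj /getv /= nth_set_nth /=; case: eqP => // _; rewrite hv.
by rewrite cell_var // ha.
Qed.

Lemma rep_seta s M w a i v : (a < 6)%N -> rep s M w ->
  rep (seta s a i v) (update M (cell a i) v) w.
Proof.
move=> a6 [hv ha hw]; split=> // [y|b j b6]; rewrite /update.
  by rewrite var_cell // hv.
rewrite cell_inj // /geta /= nth_set_nth /=.
by case: eqP => [->|_] /=; rewrite ha.
Qed.

(** * Correctness and cost of the compiled code *)

Section Correctness.

Variable B : nat.
Hypothesis B_ge8 : (8 <= B)%N.

Lemma bitlenP z : (`|z| < 2 ^ B)%N -> (bitlen z <= B)%N.
Proof. by apply: bitlen_le; apply: leq_trans B_ge8. Qed.

Lemma small_lt n : (n < 256)%N -> (n < 2 ^ B)%N.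
Proof.
by move=> h; apply: leq_trans h _; rewrite (_ : 256 = 2 ^ 8)%N // leq_exp2l.
Qed.

Lemma bitlen_small z : (`|z| < 256)%N -> (bitlen z <= B)%N.
Proof. by move=> h; apply/bitlenP/small_lt. Qed.

Lemma bitlen_tmp r : (r <= 16)%N -> (bitlen (tmp r) <= B)%N.
Proof. by move=> h; apply: bitlen_small; rewrite /tmp; lia. Qed.

Lemma bitlen_var x : (x < 16)%N -> (bitlen (var x) <= B)%N.
Proof. by move=> h; apply: bitlen_small; rewrite /var; lia. Qed.

Lemma updateE M r v : update M r v r = v.
Proof. by rewrite /update eqxx. Qed.

Lemma update_tmp M r r' v : update M (tmp r) v (tmp r') =
  if r' == r then v else M (tmp r').
Proof. by rewrite /update tmp_inj. Qed.

Lemma update_var M r x v : update M (tmp r) v (var x) = M (var x).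
Proof. by rewrite /update var_tmp. Qed.

Lemma compile_addrP P off r a s M w :
  (r < 16)%N -> (a < 6)%N -> rep s M w ->
  0 <= M (tmp r) -> (8 * `|M (tmp r)| + 8 < 2 ^ B)%N ->
  exists M', [/\ block B P off (compile_addr r a) M w M' w, rep s M' w,
    M' (tmp r) = (cell a `|M (tmp r)|)%N
    & forall r', (r' < r)%N -> M' (tmp r') = M (tmp r')].
Proof.
move=> r16 a6 sM M0 MB.
have [n nE] : exists n : nat, M (tmp r) = n by exists `|M (tmp r)|%N; rewrite gez0_abs.
rewrite nE /= in MB *.
have r1 : (r.+1 == r) = false by apply/negbTE; rewrite neq_ltn ltnSn orbT.
have r2 : (r == r.+1) = false by rewrite eq_sym.
have [br br1] := (bitlen_tmp (ltnW r16), bitlen_tmp r16).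
have b8 : (bitlen 8 <= B)%N by apply: bitlen_small.
have ba : (bitlen (a + 2)%N <= B)%N by apply: bitlen_small => /=; lia.
have bn : (bitlen n <= B)%N by apply: bitlenP => /=; lia.
have bn8 : (bitlen (n%:Z * 8) <= B)%N by apply: bitlenP; lia.
eexists; split.
- apply: block_cons; [by [] | reflexivity | rewrite /=; lia | ].
  apply: block_cons; [by [] | reflexivity | | ].
    rewrite /= !update_tmp eqxx ?r2 nE; lia.
  apply: block_cons; [by [] | reflexivity | rewrite /=; lia | ].
  apply: block_one; [by [] | reflexivity | ].
  rewrite /= !update_tmp !eqxx ?r2 ?r1 nE; lia.
- by do 4! apply: rep_tmp.
- by rewrite /= !update_tmp !eqxx ?r2 ?r1 nE /= /cell; lia.
move=> r' lt; rewrite !update_tmp (_ : r' == r = false); last by lia.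
by rewrite (_ : r' == r.+1 = false) //; lia.
Qed.

Lemma bounded_eval r e s : small_expr r e -> bounded B s e ->
  (bitlen (eval s e) <= B)%N.
Proof.
move=> se be; apply: bitlenP; case: e se be => [c|x|a e|o e e'] //=.
- by case/andP=> _ /small_lt.
- by move=> _ [].
by move=> _ [].
Qed.

(** The last clause carries the induction: the value of [e1] in [tmp r] survives the evaluation of
    [e2] in [tmp r.+1]. *)
Lemma compile_exprP P off r e s M w :
  small_expr r e -> bounded B s e -> rep s M w ->
  exists M', [/\ block B P off (compile_expr r e) M w M' w, rep s M' w,
    M' (tmp r) = eval s e
    & forall r', (r' < r)%N -> M' (tmp r') = M (tmp r')].
Proof.
elim: e r off M => [c|x|a e IH|o e1 IH1 e2 IH2] r off M /=.
- case/andP=> r16 cs _ sM.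
  have := bitlen_tmp (ltnW r16); have := bitlen_small cs => bc br.
  eexists; split; first by apply: block_one; [by [] | reflexivity | rewrite /=; lia].
  + exact: rep_tmp.
  + by rewrite update_tmp eqxx.
  by move=> r' lt; rewrite update_tmp (_ : r' == r = false) //; lia.
- case/andP=> r16 x16 xB sM.
  have br := bitlen_tmp (ltnW r16); have bx := bitlen_var x16.
  have bv := bitlenP xB; have b0 : (bitlen 0 <= B)%N by apply: bitlen_small.
  have [hv _ _] := sM.
  eexists; split.
  + apply: block_cons; [by [] | reflexivity | rewrite /=; lia | ].
    apply: block_one; [by [] | reflexivity | ].
    by rewrite /= update_tmp eqxx update_var hv; lia.
  + by do 2! apply: rep_tmp.
  + by rewrite /= update_tmp eqxx update_tmp eqxx update_var hv add0r.
  by move=> r' lt; rewrite !update_tmp (_ : r' == r = false) //; lia.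
- case/and3P=> se r16 a6 [be e0 eB aB] sM.
  have [M1 [h1 sM1 M1r M1f]] := IH r off M se be sM.
  rewrite -M1r in e0 eB.
  have [M2 [h2 sM2 M2r M2f]] :=
    compile_addrP P (off + size (compile_expr r e)) r16 a6 sM1 e0 eB.
  have br := bitlen_tmp (ltnW r16); have bv := bitlenP aB.
  have [_ ha _] := sM2.
  have M2E : M2 (cell a `|M1 (tmp r)|) = geta s a `|eval s e|%N by rewrite ha // M1r.
  have ba : (bitlen (cell a `|M1 (tmp r)|) <= B)%N.
    by apply: bitlenP; apply: leq_ltn_trans eB; rewrite /cell /=; lia.
  eexists; split.
  + apply: block_cat h1 _; apply: block_cat h2 _.
    apply: block_one; [by [] | reflexivity | ].
    by rewrite /= M2r /= M2E; lia.
  + exact: rep_tmp.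
  + by rewrite update_tmp eqxx M2r /= M2E.
  move=> r' lt; rewrite !update_tmp (_ : r' == r = false) ?M2f ?M1f //; lia.
case/and3P=> s1 s2 r16 [b1 b2 bo] sM.
have [M1 [h1 sM1 M1r M1f]] := IH1 r off M s1 b1 sM.
have [M2 [h2 sM2 M2r M2f]] := IH2 r.+1 (off + size (compile_expr r e1))%N M1 s2 b2 sM1.
have br := bitlen_tmp (ltnW r16); have br1 := bitlen_tmp r16.
have bv1 := bounded_eval s1 b1; have bv2 := bounded_eval s2 b2.
have M2r1 : M2 (tmp r) = eval s e1 by rewrite M2f.
eexists; split.
- apply: block_cat h1 _; apply: block_cat h2 _.
  apply: block_one; [by [] | reflexivity | ].
  by rewrite /= M2r M2r1; lia.
- exact: rep_tmp.
- by rewrite update_tmp eqxx M2r M2r1.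
move=> r' lt; rewrite !update_tmp (_ : r' == r = false) ?M2f ?M1f //; lia.
Qed.

(** [T] bounds the number of machine instructions, at [5 * B] each. Quantifying over the program and
    the offset makes the property compositional. *)
Definition runs (c : cmd) (s s' : state) (T : nat) :=
  forall P off M w, code_at P off (compile off c) -> rep s M w ->
  exists M' w' t, [/\ reach P (Config off M w)
                        (Config (off + size (compile off c)) M' w') t,
                      rep s' M' w' & (t <= T * (5 * B))%N].

Lemma runs_assign x e s : (x < 16)%N -> small_expr 0 e -> bounded B s e ->
  runs (Assign x e) s (setv s x (eval s e)) (size (compile_expr 0 e) + 2).
Proof.
move=> x16 se be P off M w hP sM.
have [M1 [h1 sM1 M1r _]] := compile_exprP P off se be sM.
have bv := bounded_eval se be; have bx := bitlen_var x16.
have bt0 := bitlen_tmp (leq0n 16); have bt1 := bitlen_tmp (isT : 1 <= 16)%N.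
have b0 : (bitlen 0 <= B)%N by apply: bitlen_small.
pose M2 := update M1 (tmp 1) 0.
have M20 : M2 (tmp 0) = eval s e by rewrite /M2 update_tmp.
have M21 : M2 (tmp 1) = 0 by rewrite /M2 updateE.
pose M3 := update M2 (var x) (M2 (tmp 0) + M2 (tmp 1)).
have [] : block B P off (compile off (Assign x e)) M w M3 w => //.
  apply: block_cat h1 _; apply: block_cons; [by [] | reflexivity | rewrite /=; lia | ].
  by apply: block_one; [by [] | reflexivity | rewrite /= -/M2 M20 M21; lia ].
move=> t ht tB; exists M3, w, t; split=> //; last by rewrite size_cat /= in tB.
rewrite /M3 M20 M21 addr0; apply: rep_setv; exact: rep_tmp.
Qed.

Lemma runs_store a e1 e2 s : (a < 6)%N -> small_expr 1 e1 -> small_expr 0 e2 ->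
  bounded B s e1 -> 0 <= eval s e1 -> (8 * `|eval s e1| + 8 < 2 ^ B)%N ->
  bounded B s e2 ->
  runs (Store a e1 e2) s (seta s a `|eval s e1|%N (eval s e2))
    (size (compile_expr 0 e2) + size (compile_expr 1 e1) + 5).
Proof.
move=> a6 se1 se2 be1 e10 eB be2 P off M w hP sM.
have [M1 [h1 sM1 M1r _]] := compile_exprP P off se2 be2 sM.
have [M2 [h2 sM2 M2r M2f]] :=
  compile_exprP P (off + size (compile_expr 0 e2)) se1 be1 sM1.
rewrite -M2r in e10 eB.
have [M3 [h3 sM3 M3r M3f]] := compile_addrP P
  (off + size (compile_expr 0 e2) + size (compile_expr 1 e1))
  (isT : 1 < 16)%N a6 sM2 e10 eB.
have M30 : M3 (tmp 0) = eval s e2 by rewrite M3f // M2f.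
have bv := bounded_eval se2 be2.
have bt0 := bitlen_tmp (leq0n 16); have bt1 := bitlen_tmp (isT : 1 <= 16)%N.
have ba : (bitlen (cell a `|M2 (tmp 1)|) <= B)%N.
  by apply: bitlenP; apply: leq_ltn_trans eB; rewrite /cell /=; lia.
pose M4 := update M3 `|M3 (tmp 1)|%N (M3 (tmp 0)).
have [] : block B P off (compile off (Store a e1 e2)) M w M4 w => //.
  apply: block_cat h1 _; apply: block_cat h2 _; apply: block_cat h3 _.
  by apply: block_one; [by [] | reflexivity | rewrite /= M30 M3r; lia ].
move=> t ht tB; exists M4, w, t; split=> //.
  by rewrite /M4 M30 M3r /= -M2r; apply: rep_seta.
by rewrite /= !size_cat /= addnA in tB.
Qed.

Lemma runs_input x s : (x < 16)%N -> (`|head 0%R (inp s)| < 2 ^ B)%N ->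
  runs (Input x) s (St (vars (setv s x (head 0 (inp s)))) (arrs s) (behead (inp s))) 1.
Proof.
move=> x16 /bitlenP bh P off M w hP sM; have bx := bitlen_var x16.
have wE : w = inp s by case: sM.
pose M1 := update M (var x) (head 0 w).
have [] : block B P off (compile off (Input x)) M w M1 (behead w) => //.
  apply: block_one; [by [] | reflexivity | rewrite /= wE].
  by apply: leq_trans (leq_add bx bh) _; lia.
move=> t ht tB; exists M1, (behead w), t; split=> //; rewrite /M1 wE.
by have [hv ha hw] := rep_setv x (head 0 (inp s)) sM; split.
Qed.

Lemma runs_seq c1 c2 s s1 s2 T1 T2 :
  runs c1 s s1 T1 -> runs c2 s1 s2 T2 -> runs (Seq c1 c2) s s2 (T1 + T2).
Proof.
move=> r1 r2 P off M w /code_at_cat [h1 h2] sM.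
have [M1 [w1 [t1 [ht1 sM1 t1B]]]] := r1 P off M w h1 sM.
have [M2 [w2 [t2 [ht2 sM2 t2B]]]] := r2 _ _ M1 w1 h2 sM1.
exists M2, w2, (t1 + t2)%N; split=> //; last by rewrite mulnDl leq_add.
by rewrite size_cat addnA; apply: reach_trans ht2.
Qed.

Lemma reach_at P l M w M' w' l' c' t i :
  nth Halt P l = i -> i <> Halt -> step i (Config l M w) = Config l' M' w' ->
  reach P (Config l' M' w') c' t ->
  reach P (Config l M w) c' (cost i (Config l M w) + t).
Proof.
move=> iE nH hs h; have fE : fetch P (Config l M w) = i by [].
by have := @reach_step P (Config l M w) c' t; rewrite fE hs; apply.
Qed.

(** [s j] is the state at the test that precedes turn [j], and [s' j] the state before the counter
    is incremented. A turn adds two instructions for the test and three for the increment; the final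
    4 counts the initialisation, the last test and the exit jump. *)
Lemma runs_for x n c (s s' : nat -> state) s0 (k : nat) T :
  (x < 16)%N -> (n < 16)%N -> (k < 2 ^ B)%N -> setv s0 x 0 = s 0%N ->
  (forall j, (j <= k)%N -> getv (s j) n = k /\ getv (s j) x = j) ->
  (forall j, (j < k)%N -> 
     [/\ runs c (s j) (s' j) T, getv (s' j) x = j
       & setv (s' j) x j.+1 = s j.+1]) ->
  runs (For x n c) s0 (s k) (k * (T + 5) + 4).
Proof.
move=> x16 n16 kB s0E sk hbody P off M w hP sM.
have bx := bitlen_var x16; have bn := bitlen_var n16.
have bt0 := bitlen_tmp (leq0n 16).
have b0 : (bitlen 0 <= B)%N by apply: bitlen_small.
have b1 : (bitlen 1 <= B)%N by apply: bitlen_small.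
have bj j : (j <= k)%N -> (bitlen j <= B)%N.
  by move=> jk; apply: bitlenP; apply: leq_ltn_trans kB.
have bkj j : (bitlen (k%:Z - j%:Z) <= B)%N \/ (k < j)%N.
  by case: (leqP j k) => jk; [left; apply: bitlenP; lia | right].
pose p := compile (off + 4) c.
pose pre := [:: Const (var x) 0; Op Minus (tmp 0) (var n) (var x);
   JumpPos (tmp 0) (off + 4); Jump (off + 7 + size p)].
pose post := [:: Const (tmp 0) 1; Op Plus (var x) (var x) (tmp 0); Jump off.+1].
have cE : compile off (For x n c) = pre ++ p ++ post by [].
have sz : (off + size (pre ++ p ++ post) = off + 7 + size p)%N.
  by rewrite !size_cat /=; lia.
rewrite cE in hP *; rewrite sz; have [hP1 /code_at_cat [hp hP2]] := code_at_cat hP.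
have i0 := hP1 0%N isT; have i1 := hP1 1%N isT.
have i2 := hP1 2%N isT; have i3 := hP1 3%N isT.
have j0 := hP2 0%N isT; have j1 := hP2 1%N isT; have j2 := hP2 2%N isT.
rewrite /= ?addn0 ?addn1 ?addn2 in i0 i1 i2 i3 j0 j1 j2 hp *.
(* Induction on the number [q] of turns still to come. *)
have loop q : forall j M1 w1, (j + q = k)%N -> rep (s j) M1 w1 ->
    exists M' w' t, [/\ reach P (Config off.+1 M1 w1)
                          (Config (off + 7 + size p) M' w') t,
                        rep (s k) M' w' & (t <= (q * (T + 5) + 3) * (5 * B))%N].
  elim: q => [|q IH] j M1 w1 jq sM1.
    have [vn vx] := sk j ltac:(lia); have [hv _ _] := sM1.
    pose M2 := update M1 (tmp 0) (M1 (var n) - M1 (var x)).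
    have M20 : M2 (tmp 0) = 0 by rewrite /M2 updateE !hv vn vx; lia.
    eexists M2, w1, _; split.
    - apply: reach_at i1 _ erefl _ => //; apply: reach_at i2 _ erefl _ => //.
      rewrite -/M2 M20 /= -addn3; apply: reach_at i3 _ erefl _ => //.
      exact: reach_refl.
    - by rewrite -jq addn0; apply: rep_tmp.
    - rewrite /= -/M2 M20 !hv vn vx; have := bj j; have := bj k; lia.
  have jk : (j < k)%N by lia.
  have [vn vx] := sk j (ltnW jk); have [hv _ _] := sM1.
  pose M2 := update M1 (tmp 0) (M1 (var n) - M1 (var x)).
  have M20 : M2 (tmp 0) = k%:Z - j%:Z by rewrite /M2 updateE !hv vn vx.
  have sM2 : rep (s j) M2 w1 by apply: rep_tmp.
  have [rj vx' sj] := hbody j jk.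
  have [M3 [w3 [t3 [ht3 sM3 t3B]]]] := rj _ _ M2 w1 hp sM2.
  have [hv3 _ _] := sM3.
  pose M4 := update M3 (tmp 0) 1.
  pose M5 := update M4 (var x) (M4 (var x) + M4 (tmp 0)).
  have M40 : M4 (tmp 0) = 1 by rewrite /M4 updateE.
  have M4x : M4 (var x) = j by rewrite /M4 update_var hv3.
  have sM5 : rep (s j.+1) M5 w3.
    rewrite /M5 M40 M4x -sj (_ : j%:Z + 1 = j.+1); last by lia.
    by apply: rep_setv; apply: rep_tmp.
  have [M6 [w6 [t6 [ht6 sM6 t6B]]]] := IH j.+1 M5 w3 ltac:(lia) sM5.
  eexists M6, w6, _; split; [ | exact: sM6 | ].
  - apply: reach_at i1 _ erefl _ => //; apply: reach_at i2 _ erefl _ => //.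
    rewrite -/M2 M20 (_ : 0 < k%:Z - j%:Z); last by lia.
    apply: reach_trans ht3 _; rewrite -/p.
    apply: reach_at j0 _ erefl _ => //.
    apply: reach_at j1 _ erefl _ => //.
    by apply: reach_at j2 _ erefl ht6.
  - rewrite /= -/M2 M20 -/M4 M40 M4x !hv vn vx.
    have [bkj1|] := bkj j; last by lia.
    have := bj j (ltnW jk); have := bj k (leqnn k).
    lia.
have [M' [w' [t [ht sM' tB]]]] := loop k 0%N (update M (var x) 0) w (add0n k)
  ltac:(rewrite -s0E; exact: rep_setv).
eexists M', w', _; split; [ | exact: sM' | ].
  by apply: reach_at i0 _ erefl ht.
by rewrite /=; lia.
Qed.

End Correctness.

(** * The Faddeev-LeVerrier recurrence *)

Lemma deriv_prod (R : comNzRingType) (I : eqType) (r : seq I)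
    (F : I -> {poly R}) : uniq r ->
  (\prod_(i <- r) F i)^`() =
  \sum_(i <- r) (F i)^`() * \prod_(j <- r | j != i) F j.
Proof.
elim: r => [_|x r IH /= /andP[xr ur]]; first by rewrite !big_nil derivC.
rewrite !big_cons derivM IH // eqxx /=; congr (_ * _ + _).
  rewrite big_seq_cond [RHS]big_seq_cond; apply: eq_bigl => i.
  by case: eqP => [->|]; rewrite ?(negbTE xr) ?andbF ?andbT.
rewrite mulr_sumr; apply: eq_big_seq => i ir.
rewrite big_cons eq_sym; case: eqP => [xi|_]; first by rewrite -xi ir in xr.
by rewrite mulrCA.
Qed.

Lemma deriv_det (R : comNzRingType) n (A : 'M[{poly R}]_n) :
  (\det A)^`() =
  \sum_i \det (\matrix_(k, l) if k == i then (A k l)^`() else A k l).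
Proof.
rewrite /determinant raddf_sum /= exchange_big /=; apply: eq_bigr => s _.
rewrite -mulr_sumr -signr_odd; case: (odd _); rewrite ?expr1 ?expr0 ?mulN1r ?mul1r.
all: rewrite ?derivN deriv_prod ?index_enum_uniq //; try congr (- _).
all: apply: eq_bigr => i _; rewrite [RHS](bigD1 i) //= mxE eqxx; congr (_ * _).
all: by apply: eq_bigr => k /negbTE ki; rewrite mxE ki.
Qed.

Section FaddeevLeVerrier.

Variables (R : comNzRingType) (n : nat) (K : 'M[R]_n).

(** Jacobi's formula: differentiation turns row [i] of [X - K] into a unit row, and expanding along
    it leaves the [i]-th diagonal cofactor. *)
Lemma deriv_char_poly : (char_poly K)^`() = \tr (\adj (char_poly_mx K)).
Proof.
rewrite deriv_det; apply: eq_bigr => i _; rewrite mxE.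
rewrite (expand_det_row _ i) (bigD1 i) //= big1 => [|j ji].
  rewrite !mxE !eqxx derivB derivX derivC subr0 mul1r addr0.
  congr (_ * \det _); apply/matrixP => k l; rewrite !mxE.
  by rewrite eq_sym (negbTE (neq_lift _ _)).
by rewrite !mxE eqxx eq_sym (negbTE ji) derivB mulr0n derivC subr0 derivC mul0r.
Qed.

Definition adj_coef i : 'M[R]_n := map_mx (coefp i) (\adj (char_poly_mx K)).

(** Compare the coefficients of degree [i.+1] in the identity between [X - K] times its adjugate and
    the scalar matrix of the characteristic polynomial. *)
Lemma adj_coefS i :
  adj_coef i = K *m adj_coef i.+1 + ((char_poly K)`_i.+1)%:M.
Proof.
have := mul_mx_adj (char_poly_mx K).
move=> /(congr1 (map_mx (coefp i.+1))) /matrixP E; apply/matrixP => a b.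
have := E a b; rewrite /char_poly_mx mulmxBl mul_scalar_mx !mxE /= !coefB.
rewrite coefXM /= coefMn -/(char_poly K) => <-; rewrite [RHS]addrC coef_sum.
rewrite -[LHS](subrK (\sum_j K a j * adj_coef i.+1 j b)); congr (_ - _ + _).
apply: eq_bigr => j _; rewrite !mxE coefCM.
by [].
Qed.

(** From index [n] on the recurrence reads [adj_coef i = K *m adj_coef i.+1]; iterated beyond the
    degree of every entry of the adjugate, it gives 0. *)
Lemma adj_coef_ge i : (n <= i)%N -> adj_coef i = 0.
Proof.
have coef0 j : (n <= j)%N -> (char_poly K)`_j.+1 = 0.
  by move=> nj; rewrite nth_default // size_char_poly.
move=> ni.
have step j : adj_coef i = iter j (mulmx K) (adj_coef (i + j)).
  elim: j => [|j IH]; first by rewrite addn0.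
  rewrite IH [adj_coef (i + j)]adj_coefS coef0 ?(leq_trans ni) ?leq_addr //.
  by rewrite raddf0 addr0 addnS iterSr.
pose s := \max_(ab : 'I_n * 'I_n) size (\adj (char_poly_mx K) ab.1 ab.2).
have -> : adj_coef i = iter s (mulmx K) 0.
  rewrite (step s); congr iter; apply/matrixP => a b; rewrite [LHS]mxE [RHS]mxE /=.
  rewrite nth_default // (leq_trans _ (leq_addl _ _)) //.
  exact: (leq_bigmax (F := fun ab => size (\adj (char_poly_mx K) ab.1 ab.2)) (a, b)).
by elim: s {step} => //= s ->; rewrite mulmx0.
Qed.

Lemma adj_coef_last i : n = i.+1 -> adj_coef i = 1%:M.
Proof.
move=> ni; rewrite adj_coefS adj_coef_ge ?ni // mulmx0 add0r -ni.
by have /monicP := char_poly_monic K; rewrite /lead_coef size_char_poly => ->.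
Qed.

Lemma mxtrace_adj_coef i : \tr (adj_coef i) = (char_poly K)`_i.+1 *+ i.+1.
Proof.
rewrite -coef_deriv deriv_char_poly coef_sum.
by apply: eq_bigr => j _; rewrite mxE.
Qed.

(* The coefficients of the adjugate, rescaled by factorials so that no division
   is ever needed. *)
Fixpoint fl_mx k : 'M[R]_n :=
  if k is k'.+1 then
    k%:R *: (K *m fl_mx k') + (- \tr (K *m fl_mx k'))%:M
  else 1%:M.

Definition fl_coef k := - \tr (K *m fl_mx k).

Lemma mul_adj_coef0 : - (K *m adj_coef 0) = ((char_poly K)`_0)%:M.
Proof.
have := mul_mx_adj (char_poly_mx K).
move=> /(congr1 (map_mx (coefp 0%N))) /matrixP E; apply/matrixP => a b.
have := E a b; rewrite /char_poly_mx mulmxBl mul_scalar_mx !mxE /= !coefB.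
rewrite coefXM /= coefMn -/(char_poly K) sub0r => <-; rewrite coef_sum.
by congr (- _); apply: eq_bigr => j _; rewrite !mxE coefCM.
Qed.

(** For [i > 0], take traces in [adj_coefS] and substitute [mxtrace_adj_coef]; the constant term of
    the adjugate identity settles [i = 0]. *)
Lemma mxtrace_mul_adj_coef i : (i <= n)%N ->
  - \tr (K *m adj_coef i) = (char_poly K)`_i *+ (n - i).
Proof.
case: i => [|i] ltin.
  by rewrite -raddfN /= mul_adj_coef0 mxtrace_scalar subn0.
have := mxtrace_adj_coef i; rewrite adj_coefS raddfD /= mxtrace_scalar.
by move=> E; rewrite mulrnBr // -E opprD addrCA subrr addr0.
Qed.

(** The recurrence runs down from the top coefficient of the adjugate. By [mxtrace_mul_adj_coef] the
    trace at step [k] carries a factor [k], which the classical recurrence divides out and the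
    scaling by factorials absorbs. *)
Lemma fl_mxE k : (k < n)%N -> fl_mx k = (k`!)%:R *: adj_coef (n - k.+1).
Proof.
elim: k => [|k IH] ltkn.
  by rewrite adj_coef_last ?scale1r // subn1 prednK.
rewrite [fl_mx _]/= IH 1?ltnW // -scalemxAr scalerA -natrM -factS.
have ni : (n - k.+1 = (n - k.+2).+1)%N by lia.
rewrite mxtraceZ -mulrN mxtrace_mul_adj_coef ?leq_subr // subKn 1?ltnW //.
rewrite [in RHS]adj_coefS -ni scalerDr; congr (_ + _).
by rewrite scale_scalar_mx mulrnAr -mulrnAl -mulrnA mulnC -factS.
Qed.

Lemma fl_coefE k : (k < n)%N ->
  fl_coef k = (k.+1`!)%:R * (char_poly K)`_(n - k.+1).
Proof.
move=> ltkn; rewrite /fl_coef fl_mxE // -scalemxAr mxtraceZ -mulrN.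
rewrite mxtrace_mul_adj_coef ?leq_subr // subKn //.
by rewrite mulrnAr -mulrnAl -mulrnA mulnC -factS.
Qed.

End FaddeevLeVerrier.

(** The factorials are positive; the coefficients that [fl_coef] does not reach are the leading 1
    and zeros. *)
Lemma char_poly_coef_ge0 n (K : 'M[int]_n) :
  (forall i, 0 <= (char_poly K)`_i) <-> (forall k, (k < n)%N -> 0 <= fl_coef K k).
Proof.
have fact_gt0 k : (0 : int) < (k`!)%:R by rewrite ltr0n fact_gt0.
split=> [h k ltkn|h i]; first by rewrite fl_coefE // mulr_ge0 ?ler0n.
case: (ltngtP i n) => [ltin|ltni|->].
- have ltkn : (n - i.+1 < n)%N by lia.
  by have := h _ ltkn; rewrite fl_coefE // pmulr_rge0 // (_ : n - _ = i)%N //; lia.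
- by rewrite nth_default // size_char_poly.
by have /monicP := char_poly_monic K; rewrite /lead_coef size_char_poly => ->.
Qed.

(** * The averaging operator *)

Section Averaging.

Variables (S : comNzRingType) (d m : nat).
Implicit Types A : 'I_m -> 'M[S]_d.

Lemma hi_subproof (p : 'I_(d * d)) : (p %/ d < d)%N.
Proof. by rewrite ltn_divLR; case: d p => [[]|]. Qed.

Lemma lo_subproof (p : 'I_(d * d)) : (p %% d < d)%N.
Proof. by rewrite ltn_mod; case: d p => [[]|]. Qed.

Lemma pair_subproof (i j : 'I_d) : (i * d + j < d * d)%N.
Proof. by have := ltn_ord i; have := ltn_ord j; nia. Qed.

Definition hi p : 'I_d := Ordinal (hi_subproof p).
Definition lo p : 'I_d := Ordinal (lo_subproof p).
Definition pair_idx i j : 'I_(d * d) := Ordinal (pair_subproof i j).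

Lemma hi_pair i j : hi (pair_idx i j) = i.
Proof.
apply: val_inj; rewrite /= divnMDl ?divn_small ?addn0 //.
by rewrite (leq_trans _ (ltn_ord i)).
Qed.

Lemma lo_pair i j : lo (pair_idx i j) = j.
Proof. by apply: val_inj; rewrite /= modnMDl modn_small. Qed.

Lemma pair_hi_lo p : pair_idx (hi p) (lo p) = p.
Proof. by apply: val_inj; rewrite /= -divn_eq. Qed.

Lemma sum_pair (V : nmodType) (F : 'I_d -> 'I_d -> V) :
  \sum_p F (hi p) (lo p) = \sum_i \sum_j F i j.
Proof.
rewrite pair_big /= (reindex (fun ij : 'I_d * 'I_d => pair_idx ij.1 ij.2)) /=.
  by apply: eq_bigr => -[i j] _ /=; rewrite hi_pair lo_pair.
exists (fun p => (hi p, lo p)) => [[i j] _|p _] /=.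
  by rewrite hi_pair lo_pair.
exact: pair_hi_lo.
Qed.

(* Acting on row vectors, this is the matrix of [X |-> sum_k (A k)^T X (A k)]. *)
Definition kron A : 'M[S]_(d * d) :=
  \matrix_(p, q) \sum_k A k (hi p) (hi q) * A k (lo p) (lo q).

Definition unrow (y : 'rV[S]_(d * d)) : 'M[S]_d :=
  \matrix_(i, j) y 0 (pair_idx i j).

Lemma unrow_inj : injective unrow.
Proof.
move=> y y' /matrixP E; apply/rowP => p.
by have := E (hi p) (lo p); rewrite !mxE pair_hi_lo.
Qed.

Lemma unrow_kron A y :
  unrow (y *m kron A) = \sum_k (A k)^T *m unrow y *m A k.
Proof.
apply/matrixP => a b; rewrite summxE !mxE.
transitivity (\sum_p \sum_k A k (hi p) a * unrow y (hi p) (lo p) * A k (lo p) b).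
  apply: eq_bigr => p _; rewrite !mxE hi_pair lo_pair pair_hi_lo mulr_sumr.
  by apply: eq_bigr => k _; rewrite mulrA; congr (_ * _); rewrite mulrC.
rewrite exchange_big /=; apply: eq_bigr => k _.
rewrite (sum_pair (fun i j => A k i a * unrow y i j * A k j b)) exchange_big /= mxE.
apply: eq_bigr => j _; rewrite mxE mulr_suml.
by apply: eq_bigr => i _; rewrite !mxE.
Qed.

(** The shift moves the disc of radius [m] around 0 into the closed left half-plane. *)
Definition test_mx A : 'M[S]_(d * d) := kron A - (m%:R)%:M.

End Averaging.

Lemma map_test_mx (S S' : comNzRingType) (f : {rmorphism S -> S'}) d m
    (A : 'I_m -> 'M[S]_d) :
  map_mx f (test_mx A) = test_mx (fun k => map_mx f (A k)).
Proof.
apply/matrixP => p q; rewrite !mxE rmorphB rmorph_sum /= rmorphMn rmorph_nat.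
by congr (_ - _); apply: eq_bigr => k _; rewrite !mxE rmorphM.
Qed.

(** * Quadratic forms *)

Section QuadraticForm.

Variables (S : comNzRingType) (d : nat).
Implicit Types (Z : 'M[S]_d) (u v : 'cV[S]_d).

Definition qf Z v : S := (v^T *m Z *m v) 0 0.

Lemma qfE Z v : qf Z v = \sum_i \sum_j v i 0 * Z i j * v j 0.
Proof.
rewrite /qf mxE exchange_big; apply: eq_bigr => j _; rewrite mxE mulr_suml.
by apply: eq_bigr => i _; rewrite mxE.
Qed.

Lemma qf_conj Z (B : 'M[S]_d) v : qf (B^T *m Z *m B) v = qf Z (B *m v).
Proof. by rewrite /qf trmx_mul !mulmxA. Qed.

Lemma qfD Z Z' v : qf (Z + Z') v = qf Z v + qf Z' v.
Proof. by rewrite /qf mulmxDr mulmxDl mxE. Qed.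

Lemma qf_sum m (Z : 'I_m -> 'M[S]_d) v : qf (\sum_k Z k) v = \sum_k qf (Z k) v.
Proof. by rewrite /qf mulmx_sumr mulmx_suml summxE. Qed.

Lemma qfZ c Z v : qf (c *: Z) v = c * qf Z v.
Proof. by rewrite /qf -scalemxAr -scalemxAl mxE. Qed.

(** For a general matrix [Z] the polar form is given by [Z + Z^T]. *)
Lemma qf_add Z u v c : qf Z (u + c *: v) =
  qf Z u + c * (u^T *m (Z + Z^T) *m v) 0 0 + c ^+ 2 * qf Z v.
Proof.
have tr (x : 'M[S]_1) : x 0 0 = x^T 0 0 by rewrite mxE.
have E : (u + c *: v)^T = u^T + c *: v^T by rewrite linearD linearZ.
have vu : (v^T *m Z *m u) 0 0 = (u^T *m Z^T *m v) 0 0.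
  by rewrite tr !trmx_mul trmxK mulmxA.
rewrite /qf E !(mulmxDl, mulmxDr, =^~ scalemxAl, =^~ scalemxAr).
have addE (x y : 'M[S]_1) : (x + y) 0 0 = x 0 0 + y 0 0 by rewrite mxE.
have scaleE a (x : 'M[S]_1) : (a *: x) 0 0 = a * x 0 0 by rewrite mxE.
rewrite !(addE, scaleE) vu; ring.
Qed.

Lemma qf0 Z : qf Z 0 = 0.
Proof. by rewrite /qf mulmx0 mxE. Qed.

End QuadraticForm.

Lemma map_qf (S S' : comNzRingType) (f : {rmorphism S -> S'}) d
    (Z : 'M[S]_d) v : f (qf Z v) = qf (map_mx f Z) (map_mx f v).
Proof. by rewrite /qf map_trmx -!map_mxM [RHS]mxE. Qed.

(** A subspace of maximal dimension among those contained in [D] is all of [D]: together with a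
    further vector of [D] it would span a larger one. *)
Lemma vspace_of_pred (K : fieldType) (V : vectType K) (D : V -> Prop) :
  D 0 -> (forall a u v, D u -> D v -> D (a *: u + v)) ->
  exists U : {vspace V}, forall v, v \in U <-> D v.
Proof.
move=> D0 Dlin.
pose good n := `[< exists2 U : {vspace V}, \dim U = n & forall v, v \in U -> D v >].
have ex0 : exists n, good n.
  exists 0%N; apply/asboolP; exists 0%VS; first by rewrite dimv0.
  by move=> v; rewrite memv0 => /eqP ->.
have bnd n : good n -> (n <= \dim {:V})%N.
  by move=> /asboolP [U <- _]; apply: dimvS; apply: subvf.
case: (ex_maxnP ex0 bnd) => n /asboolP [U dU UD] nmax.
exists U => v; split=> [/UD //|Dv]; apply: contrapT => /negP vU.
have : (n.+1 <= n)%N; last by rewrite ltnn.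
apply: nmax; apply/asboolP; exists (U + <[v]>)%VS.
  rewrite dimv_disjoint_sum ?dU ?dim_vline.
    have -> : v != 0 by apply: contraNneq vU => ->; rewrite mem0v.
    by rewrite addn1.
  apply/eqP; rewrite -subv0; apply/subvP => u; rewrite memv_cap => /andP[uU].
  case/vlineP=> a ua; rewrite memv0 ua; case: (eqVneq a 0) => [->|a0].
    by rewrite scale0r.
  by case/negP: vU; rewrite -(scale1r v) -(mulVf a0) -scalerA -ua memvZ.
move=> u /memv_addP [u1 u1U [u2 /vlineP [a ->] ->]].
by rewrite addrC; apply: Dlin => //; apply: UD.
Qed.

Definition nsq (R : comNzRingType) d (v : 'cV[R]_d) : R := \sum_i v i 0 ^+ 2.

(** * Semidefinite and definite real forms *)

Section RealForms.

Variables (R : realFieldType) (d : nat).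
Implicit Types (Z : 'M[R]_d) (u v : 'cV[R]_d).

Lemma nsqE v : nsq v = qf 1%:M v.
Proof.
rewrite qfE; apply: eq_bigr => i _; rewrite (bigD1 i) //= big1 => [|j ji].
  by rewrite mxE eqxx mulr1 addr0 expr2.
by rewrite mxE eq_sym (negbTE ji) mulr0 mul0r.
Qed.

Lemma sqr_le_nsq v i : v i 0 ^+ 2 <= nsq v.
Proof.
by rewrite /nsq (bigD1 i) //= lerDl sumr_ge0 // => j _; apply: sqr_ge0.
Qed.

Lemma nsq_ge0 v : 0 <= nsq v.
Proof. by apply: sumr_ge0 => i _; apply: sqr_ge0. Qed.

Lemma qf_le Z c v : (forall i j, `|Z i j| <= c) ->
  `|qf Z v| <= c *+ (d * d) * nsq v.
Proof.
move=> Zc; rewrite qfE (le_trans (ler_norm_sum _ _ _)) //.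
have -> : c *+ (d * d) * nsq v = \sum_(i < d) \sum_(j < d) c * nsq v.
  by rewrite !sumr_const !card_ord -mulrnA mulrnAl.
apply: ler_sum => i _; rewrite (le_trans (ler_norm_sum _ _ _)) //.
apply: ler_sum => j _; rewrite !normrM mulrAC mulrC.
have vv : `|v i 0| * `|v j 0| <= nsq v.
  have := sqr_le_nsq v i; have := sqr_le_nsq v j.
  rewrite -[v i 0 ^+ 2]real_normK ?num_real // -[v j 0 ^+ 2]real_normK ?num_real //.
  have := sqr_ge0 (`|v i 0| - `|v j 0|); nra.
by apply: ler_pM => //; apply: mulr_ge0.
Qed.

Lemma qf_bound Z : exists2 c, 0 <= c & forall v, `|qf Z v| <= c * nsq v.
Proof.
pose c := \sum_i \sum_j `|Z i j|.
have c0 : 0 <= c by apply: sumr_ge0 => i _; apply: sumr_ge0 => j _.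
exists (c *+ (d * d)); first by rewrite mulrn_wge0.
move=> v; apply: qf_le => i j.
rewrite /c (bigD1 i) //= (bigD1 j) //= -addrA lerDl addr_ge0 ?sumr_ge0 //.
by move=> k _; apply: sumr_ge0.
Qed.

Variable Z : 'M[R]_d.
Hypothesis Z_ge0 : forall v, 0 <= qf Z v.

(** Between isotropic vectors only the cross term survives; it changes sign with [a], so
    nonnegativity for both signs makes it vanish. *)
Lemma psd_kernel a u v : qf Z u = 0 -> qf Z v = 0 -> qf Z (a *: u + v) = 0.
Proof.
move=> zu zv; apply/eqP; rewrite eq_le Z_ge0 andbT.
have := Z_ge0 (v + (- a) *: u); rewrite [a *: u + v]addrC !qf_add zu zv; lra.
Qed.

Hypothesis Z_gt0 : forall v, qf Z v = 0 -> v = 0.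

Lemma pd_cauchy_schwarz u v :
  (u^T *m (Z + Z^T) *m v) 0 0 ^+ 2 <= 4 * qf Z u * qf Z v.
Proof.
set b := (_ *m v) 0 0.
have [zv|zv] := eqVneq (qf Z v) 0.
  by rewrite /b (Z_gt0 zv) mulmx0 mxE qf0 mulr0 expr0n.
have zv0 : 0 < qf Z v by rewrite lt_neqAle eq_sym zv Z_ge0.
(* The scalar is the minimum point of [c |-> qf Z (u + c *: v)]. *)
have := Z_ge0 (u + (- b / (2 * qf Z v)) *: v); rewrite qf_add -/b => h.
have := mulr_ge0 (ltW zv0) h.
have -> : qf Z v * (qf Z u + - b / (2 * qf Z v) * b + (- b / (2 * qf Z v)) ^+ 2 * qf Z v)
  = qf Z u * qf Z v - b ^+ 2 / 4 by field.
lra.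
Qed.

(** Each coordinate of [v] is the polar form of [v] with a fixed vector, a row of the inverse of
    [Z + Z^T]; the Cauchy-Schwarz inequality then applies. *)
Lemma pd_coercive : exists2 c, 0 < c & forall v i, v i 0 ^+ 2 <= c * qf Z v.
Proof.
pose Y := Z + Z^T.
(* A vector in the kernel of [Y] is isotropic for [Z], hence zero. *)
have Yu : Y \in unitmx.
  rewrite -row_free_unit -kermx_eq0; apply/eqP/row_matrixP => i.
  have /sub_kermxP := row_sub i (kermx Y); set u := row i _ => uY.
  have : qf Z (u^T + 1 *: u^T) = 0.
    rewrite qf_add trmxK -/Y uY mul0mx mxE.
    have : qf Y u^T = 0 by rewrite /qf trmxK uY mul0mx mxE.
    rewrite qfD.
    have -> : qf Z^T u^T = qf Z u^T.
      have tr (x : 'M[R]_1) : x 0 0 = x^T 0 0 by rewrite mxE.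
      by rewrite /qf [LHS]tr !trmx_mul !trmxK mulmxA.
    lra.
  move=> /Z_gt0 /eqP.
  rewrite scale1r -mulr2n -scaler_nat scaler_eq0 pnatr_eq0 /= row0.
  by rewrite -trmx_eq0 trmxK => /eqP.
pose w i : 'cV[R]_d := (row i (invmx Y))^T.
exists (1 + 4 * \sum_i qf Z (w i)).
  by rewrite ltr_pwDl // mulr_ge0 // sumr_ge0.
move=> v i; have := pd_cauchy_schwarz (w i) v.
have -> : ((w i)^T *m (Z + Z^T) *m v) 0 0 = v i 0.
  rewrite /w trmxK -/Y -row_mul mulVmx // -row_mul mul1mx.
  by rewrite mxE.
move=> /le_trans; apply; apply: ler_wpM2r => //.
rewrite (bigD1 i) //=.
have : 0 <= \sum_(j | j != i) qf Z (w j) by apply: sumr_ge0.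
lra.
Qed.

End RealForms.

(** * A subinvariant form forces finiteness *)

Section FiniteSets.

Local Open Scope classical_set_scope.

Lemma bounded_finite_set d (D : set 'M[int]_d) (c : nat) :
  (forall B, D B -> forall i j, (`|B i j| <= c)%N) -> finite_set D.
Proof.
move=> Dc.
pose f (g : 'M['I_(c + c).+1]_d) : 'M[int]_d := \matrix_(i, j) ((g i j)%:Z - c%:Z).
apply: (@sub_finite_set _ _ (f @` [set: 'M['I_(c + c).+1]_d])); last first.
  by apply: finite_image; apply: finite_finset.
move=> B DB; exists (\matrix_(i, j) inord `|(B i j + c%:Z)%R|%N) => //.
apply/matrixP => i j; rewrite !mxE inordK; have := Dc B DB i j; lia.
Qed.

Lemma finite_set_argmin (R : realFieldType) (T : eqType) (D : set T) (f : T -> R) :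
  finite_set D -> D !=set0 -> exists2 x, D x & forall y, D y -> f x <= f y.
Proof.
case/finite_seqP => s -> [x0 /= x0s].
elim: s x0 x0s => // x s IH x0 _.
case: s IH => [|y s] IH; first by exists x => [|y]; rewrite /= ?inE // => /eqP ->.
have [z zs zmin] := IH y (mem_head _ _).
have [xz|zx] := leP (f x) (f z).
  exists x; first exact: mem_head.
  move=> t /=; rewrite inE => /orP[/eqP -> //|/zmin]; exact: le_trans.
exists z; first by rewrite /= inE; apply/orP; right.
move=> t /=; rewrite inE => /orP[/eqP ->|/zmin //]; exact: ltW.
Qed.

End FiniteSets.

Lemma word_product_cons d m (A : 'I_m -> 'M[int]_d) k s :
  word_product A (k :: s) = A k *m word_product A s.
Proof. by rewrite /word_product big_cons. Qed.

Lemma word_product_cat d m (A : 'I_m -> 'M[int]_d) s t :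
  word_product A (s ++ t) = word_product A s *m word_product A t.
Proof. by rewrite /word_product big_cat. Qed.

Section Endgame.

Local Open Scope classical_set_scope.

Variables (R : realType) (d m : nat) (A : 'I_m -> 'M[int]_d).
Hypotheses (m_gt0 : (0 < m)%N) (irrA : irreducible A R) (nmA : non_mortal A).

Local Notation toR B := (map_mx (intr : int -> R) B).

(** Irreducibility, transferred from subspaces to predicates closed under linear combinations. *)
Lemma invariant_pred (D : 'cV[R]_d -> Prop) :
  D 0 -> (forall a u v, D u -> D v -> D (a *: u + v)) ->
  (forall k v, D v -> D (toR (A k) *m v)) ->
  (forall v, D v -> v = 0) \/ (forall v, D v).
Proof.
move=> D0 Dlin Dinv; have [U UD] := vspace_of_pred D0 Dlin.
case: (irrA (W := U)) => [k v /UD Dv|U0|UT].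
- by apply/UD; apply: Dinv.
- by left=> v /UD; rewrite U0 memv0 => /eqP.
by right=> v; apply/UD; rewrite UT memvf.
Qed.

Definition orbit_bounded (v : 'cV[R]_d) : Prop :=
  exists c : R, forall s i, `|(toR (word_product A s) *m v) i 0| <= c.

(** The vectors of bounded orbit form an invariant subspace: the orbit of [A k *m v] lies in that of
    [v]. *)
Lemma orbit_bounded_all v0 : v0 <> 0 -> orbit_bounded v0 ->
  forall v, orbit_bounded v.
Proof.
move=> v00 bv0; case: (@invariant_pred orbit_bounded) => //.
- by exists 0 => s i; rewrite mulmx0 mxE normr0.
- move=> a u v [cu hu] [cv hv]; exists (`|a| * cu + cv) => s i.
  rewrite mulmxDr -scalemxAr !mxE (le_trans (ler_normD _ _)) // lerD //.
    by rewrite normrM ler_wpM2l //; have := hu s i; rewrite mxE.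
  by have := hv s i; rewrite mxE.
- move=> k v [c hv]; exists c => s i.
  by rewrite mulmxA -map_mxM; have := hv (rcons s k) i;
     rewrite -cats1 word_product_cat word_product_cons /word_product big_nil mulmx1.
by move=> h; case: v00; apply: h.
Qed.

Variable Z : 'M[R]_d.
Hypothesis Z_ge0 : forall v, 0 <= qf Z v.
Hypothesis Z_neq0 : exists v, qf Z v != 0.
Hypothesis Z_sub : forall v, \sum_k qf Z (toR (A k) *m v) <= m%:R * qf Z v.

(** At an isotropic vector [Z_sub] bounds a sum of nonnegative terms by 0, so the kernel of [Z] is
    invariant; by [Z_neq0] it is not the whole space. *)
Lemma subinvariant_gt0 v : qf Z v = 0 -> v = 0.
Proof.
case: (@invariant_pred (fun v => qf Z v = 0)) => //.
- exact: qf0.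
- by move=> a u w; apply: psd_kernel.
- move=> k w zw; have := Z_sub w; rewrite zw mulr0 => h.
  apply/eqP; rewrite eq_le Z_ge0 andbT (le_trans _ h) //.
  by rewrite (bigD1 k) //= lerDl sumr_ge0.
- by move=> h; apply: h.
by move=> h; have [w /eqP zw] := Z_neq0; case: zw; apply: h.
Qed.

Definition energy (B : 'M[int]_d) : R := \sum_j qf Z (toR (col j B)).

Lemma energy_sub B : \sum_k energy (A k *m B) <= m%:R * energy B.
Proof.
rewrite exchange_big mulr_sumr; apply: ler_sum => j _.
apply: le_trans (Z_sub _); apply: ler_sum => k _.
by rewrite colE -mulmxA -colE map_mxM.
Qed.

Lemma energy_bound (e : R) :
  exists c : nat, forall B, energy B <= e -> forall i j, (`|B i j| <= c)%N.
Proof.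
have [c c0 hc] := pd_coercive Z_ge0 subinvariant_gt0.
(* From [x ^+ 2 <= y] follows [x <= 1 + y], which avoids a square root. *)
exists (Num.bound (1 + c * `|e|)) => B Be i j.
have h : ((`|B i j|%N)%:R : R) ^+ 2 <= c * `|e|.
  rewrite natr_absz intr_norm real_normK ?num_real //.
  have := hc (toR (col j B)) i; rewrite !mxE => /le_trans; apply.
  rewrite ler_wpM2l ?(ltW c0) // (le_trans _ (le_trans Be (ler_norm e))) //.
  by rewrite /energy (bigD1 j) //= lerDl sumr_ge0.
have n0 : (0 : R) <= (`|B i j|%N)%:R by apply: ler0n.
have e0 := normr_ge0 e.
have /archi_boundP : 0 <= 1 + c * `|e| by nra.
rewrite -(ler_nat R) => hb; apply/ltW; apply: le_lt_trans hb; nra.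
Qed.

Lemma finite_of_subinvariant : finite_set (generated_semigroup A).
Proof.
pose k0 : 'I_m := Ordinal m_gt0.
(* A sublevel set of the energy is finite, its elements being integer matrices with bounded entries.
   A minimum over this nonempty one is a minimum over the semigroup. *)
pose D := [set B | generated_semigroup A B /\
                   energy B <= energy (word_product A [:: k0])].
have finD : finite_set D.
  have [c hc] := energy_bound (energy (word_product A [:: k0])).
  by apply: (@bounded_finite_set _ _ c) => B [_ /hc].
have [|B0 [[s0 s0n B0E] B0k] B0min'] := finite_set_argmin energy finD.
  by exists (word_product A [:: k0]); split=> //; exists [:: k0].
have B0min B : generated_semigroup A B -> energy B0 <= energy B.
  move=> SB; have [BB0|/ltW //] := leP (energy B) (energy B0).
  by apply: B0min'; split=> //; apply: le_trans BB0 _.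
(* If [B] has minimal energy, each of the [m] values [energy (A k *m B)] is at least the minimum and
   their sum is at most [m] times it, so all are equal to it. *)
have B0const s : energy (word_product A s *m B0) = energy B0.
  elim: s => [|k s IH]; first by rewrite /word_product big_nil mul1mx.
  have inS k' : energy B0 <= energy (word_product A (k' :: s) *m B0).
    by apply: B0min; exists ((k' :: s) ++ s0); rewrite // B0E word_product_cat.
  apply/eqP; rewrite eq_le inS andbT.
  have := energy_sub (word_product A s *m B0); rewrite IH (bigD1 k) //=.
  rewrite mulmxA -word_product_cons => h.
  have : \sum_(i < m | i != k) energy B0 <=
         \sum_(i < m | i != k) energy (A i *m (word_product A s *m B0)).
    by apply: ler_sum => k' _; rewrite mulmxA -word_product_cons.
  have : \sum_(i < m) energy B0 = m%:R * energy B0.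
    by rewrite sumr_const card_ord mulr_natl.
  rewrite (bigD1 k) //=; lra.
(* Non-mortality provides a nonzero column, and the constant energy bounds its orbit. *)
have B0n : B0 <> 0 by rewrite B0E; apply: nmA.
have [j B0j] : exists j, col j B0 != 0.
  apply: contrapT => h; apply: B0n; apply/matrixP => i j; rewrite mxE.
  have /negP/negPn/eqP/colP/(_ i) : ~ (col j B0 != 0) by move=> H; apply: h; exists j.
  by rewrite !mxE.
have [c hc] := energy_bound (energy B0).
have bj : orbit_bounded (toR (col j B0)).
  exists c%:R => s i; rewrite -map_mxM colE mulmxA -colE !mxE.
  rewrite -intr_norm -natr_absz ler_nat; have := hc (word_product A s *m B0).
  by rewrite B0const lexx => /(_ isT i j); rewrite mxE.
have colj0 : toR (col j B0) <> 0.
  move=> /matrixP h; case/eqP: B0j; apply/matrixP => a b.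
  by have /eqP := h a b; rewrite !mxE intr_eq0 => /eqP.
have all_bd := orbit_bounded_all colj0 bj.
(* The entries of a product are the coordinates of its values on the basis vectors, so the bounded
   orbits of these bound the whole semigroup. *)
pose e i : 'cV[R]_d := delta_mx i 0.
have /choice [f hf] : forall i, exists c : R,
    forall s i', `|(toR (word_product A s) *m e i) i' 0| <= c.
  by move=> i; apply: all_bd.
apply: (@bounded_finite_set _ _ (Num.bound (\sum_i `|f i|))) => _ [s _ ->] a b.
have := hf b s a; rewrite -colE !mxE -intr_norm -natr_absz => h.
rewrite -(ler_nat R); apply: le_trans h _; apply: le_trans (ler_norm _) _.
apply: le_trans (ltW (archi_boundP _)); last by apply: sumr_ge0.
by rewrite [X in _ <= X](bigD1 b) //= lerDl sumr_ge0.
Qed.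

End Endgame.

(** * Nonnegative coefficients give an invariant form *)

Section PolyLipschitz.

Variable R : realFieldType.
Implicit Types (p : {poly R}) (M : R).

Lemma horner_bound p M : 0 <= M ->
  exists2 c, 0 <= c & forall x, 0 <= x <= M -> `|p.[x]| <= c.
Proof.
move=> M0; elim/poly_ind: p => [|p a [c c0 hc]].
  by exists 0 => // x _; rewrite horner0 normr0.
exists (c * M + `|a|) => [|x xM]; first by rewrite addr_ge0 ?mulr_ge0.
rewrite hornerMXaddC (le_trans (ler_normD _ _)) // lerD2r normrM.
apply: ler_pM => //; first exact: hc.
by case/andP: xM => x0 xM; rewrite ger0_norm.
Qed.

Lemma horner_lipschitz p M : 0 <= M ->
  exists2 c, 0 <= c & forall x y, 0 <= x <= M -> 0 <= y <= M ->
    `|p.[x] - p.[y]| <= c * `|x - y|.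
Proof.
move=> M0; elim/poly_ind: p => [|p a [c c0 hc]].
  by exists 0 => // x y _ _; rewrite !horner0 subrr normr0 mul0r.
have [b b0 hb] := horner_bound p M0.
exists (c * M + b) => [|x y xM yM]; first by rewrite addr_ge0 ?mulr_ge0.
rewrite !hornerMXaddC opprD addrACA subrr addr0.
have -> : p.[x] * x - p.[y] * y = (p.[x] - p.[y]) * x + p.[y] * (x - y) by ring.
rewrite (le_trans (ler_normD _ _)) // !normrM [leRHS]mulrDl; apply: lerD.
  rewrite mulrAC; apply: ler_pM => //; first exact: hc.
  by case/andP: xM => x0 xM; rewrite ger0_norm.
by apply: ler_wpM2r => //; apply: hb.
Qed.

(** Dividing by [X] preserves the sign on the positive axis and reduces to the constant term, where
    continuity at 0 decides. *)
Lemma low_coef_ge0 p k : (forall j, (j < k)%N -> p`_j = 0) ->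
  (forall t, 0 < t -> 0 <= p.[t]) -> 0 <= p`_k.
Proof.
elim: k p => [|k IH] p low pos; last first.
  have p0 : p`_0 = 0 by apply: low.
  have pE : p = drop_poly 1 p * 'X.
    have := poly_take_drop 1 p; rewrite expr1 => {1}<-.
    rewrite -[RHS]add0r; congr (_ + _).
    by apply/polyP => i; rewrite coef_take_poly coef0; case: i => //=.
  have -> : p`_k.+1 = (drop_poly 1 p)`_k by rewrite coef_drop_poly addn1.
  apply: IH => [j jk|t t0]; first by rewrite coef_drop_poly addn1 low.
  by have := pos t t0; rewrite {1}pE hornerMX pmulr_lge0.
rewrite -horner_coef0 leNgt; apply/negP => p0.
have [c c0 hc] := horner_lipschitz p (@ler01 R).
(* For this [t] the Lipschitz bound keeps [p.[t]] below [p.[0] / 2], hence negative; [c + 1] keeps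
   the denominator positive. *)
pose t := Num.min 1 (- p.[0] / (2 * (c + 1))).
have c1 : 0 < 2 * (c + 1) by lra.
have t0 : 0 < t by rewrite lt_min ltr01 divr_gt0 // oppr_gt0.
have t1 : t <= 1 by rewrite ge_min lexx.
have tc : t <= - p.[0] / (2 * (c + 1)) by rewrite ge_min lexx orbT.
have := hc t 0; rewrite (ltW t0) t1 lexx ler01 subr0 (gtr0_norm t0) => /(_ isT isT).
rewrite ler_pdivlMr // in tc; have := pos t t0.
move: (p.[t]) => q q0; rewrite ger0_norm; last by lra.
nra.
Qed.

End PolyLipschitz.

Lemma qf_lipschitz (R : realFieldType) d (W : 'M[{poly R}]_d) M : 0 <= M ->
  exists2 c, 0 <= c & forall x y v, 0 <= x <= M -> 0 <= y <= M ->
    `|qf (map_mx (horner_eval x) W) v - qf (map_mx (horner_eval y) W) v|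
       <= c * `|x - y| * nsq v.
Proof.
move=> M0.
have h ij : exists c, 0 <= c /\ forall x y, 0 <= x <= M -> 0 <= y <= M ->
    `|(W ij.1 ij.2).[x] - (W ij.1 ij.2).[y]| <= c * `|x - y|.
  by have [c c0 hc] := horner_lipschitz (W ij.1 ij.2) M0; exists c.
have [f hf] := choice h.
pose c := \sum_(ij : 'I_d * 'I_d) f ij.
have f0 ij : 0 <= f ij by case: (hf ij).
have c0 : 0 <= c by apply: sumr_ge0.
exists (c *+ (d * d)) => [|x y v xM yM]; first by rewrite mulrn_wge0.
rewrite -mulN1r -qfZ -qfD mulrnAl; apply: qf_le => i j.
rewrite !mxE /horner_eval mulN1r; have [_ /(_ x y xM yM) /le_trans] := hf (i, j).
apply; apply: ler_wpM2r => //.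
by rewrite /c (bigD1 (i, j)) //= lerDl sumr_ge0.
Qed.

(** * Positivity of the resolvent and its lowest-order coefficient *)

Section Resolvent.

Variables (R : realType) (d m : nat) (A : 'I_m -> 'M[R]_d).
Hypotheses (d_gt0 : (0 < d)%N) (m_gt0 : (0 < m)%N).

Local Notation chi := (char_poly (test_mx A)).

Hypothesis chi_ge0 : forall i, 0 <= chi`_i.

(** Where [chi] does not vanish, this is [chi (t) (t + m - Phi)^-1 (1)]. The row vector is the
    identity matrix flattened, and the adjugate keeps the entries polynomial in [t]. *)
Definition resolvent : 'M[{poly R}]_d :=
  unrow (map_mx polyC (\row_p (hi p == lo p)%:R) *m \adj (char_poly_mx (test_mx A))).

(** Multiply the adjugate by [X - test_mx A = (X + m) - kron A] and read the rows back as
    matrices. *)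
Lemma resolventE :
  ('X + m%:R) *: resolvent =
  \sum_k (map_mx polyC (A k))^T *m resolvent *m map_mx polyC (A k) + chi%:M.
Proof.
rewrite /resolvent -unrow_kron; set e := map_mx _ _; set w := e *m _.
have wE : w *m char_poly_mx (test_mx A) = chi *: e.
  by rewrite -mulmxA mul_adj_mx mul_mx_scalar.
have kE : char_poly_mx (test_mx A) =
          ('X + m%:R)%:M - kron (fun k => map_mx polyC (A k)).
  rewrite /char_poly_mx map_test_mx /test_mx opprB addrA; congr (_ - _).
  by rewrite -raddfD.
have := wE; rewrite kE mulmxBr mul_mx_scalar => /eqP.
rewrite subr_eq [eqbRHS]addrC => /eqP E.
move: E; rewrite {wE}; move: w => w E; apply/matrixP => i j.
transitivity ((('X + m%:R) *: w) 0 (pair_idx i j)); first by rewrite !mxE.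
rewrite E [LHS]mxE [RHS]mxE; congr (_ + _); first by rewrite [RHS]mxE.
rewrite !mxE hi_pair lo_pair.
by case: (i == j); rewrite ?mulr1 ?mulr0 ?polyC0 ?polyC1 ?mulr1 ?mulr0.
Qed.

Definition rform v : {poly R} := qf resolvent (map_mx polyC v).

Lemma rformE v :
  ('X + m%:R) * rform v = \sum_k rform (A k *m v) + chi * (nsq v)%:P.
Proof.
rewrite -qfZ resolventE qfD qf_sum; congr (_ + _).
  by apply: eq_bigr => k _; rewrite qf_conj /rform map_mxM.
by rewrite -scalemx1 qfZ nsqE map_qf map_scalar_mx /= polyC1.
Qed.

Lemma horner_rform v t : (rform v).[t] = qf (map_mx (horner_eval t) resolvent) v.
Proof.
rewrite -/(horner_eval t _) /rform map_qf; congr qf.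
by apply/matrixP => i j; rewrite !mxE /= /horner_eval hornerC.
Qed.

Lemma coef_rform v k : (rform v)`_k = qf (map_mx (coefp k) resolvent) v.
Proof.
rewrite /rform !qfE coef_sum; apply: eq_bigr => i _.
rewrite coef_sum; apply: eq_bigr => j _; rewrite !mxE.
by rewrite mulrC mulrA -polyCM coefCM /=; ring.
Qed.

Lemma rform_horner v t : (t + m%:R) * (rform v).[t] =
  \sum_k (rform (A k *m v)).[t] + chi.[t] * nsq v.
Proof.
have /(congr1 (horner_eval t)) := rformE v; rewrite /horner_eval.
by rewrite hornerD !hornerM hornerD hornerX -polyC_natr !hornerC horner_sum.
Qed.

Lemma chi_ge t : 0 <= t -> t ^+ (d * d) <= chi.[t].
Proof.
move=> t0; rewrite horner_coef size_char_poly big_ord_recr /=.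
have /monicP := char_poly_monic (test_mx A).
rewrite /lead_coef size_char_poly /= => ->; rewrite mul1r lerDr.
by apply: sumr_ge0 => i _; rewrite mulr_ge0 // exprn_ge0.
Qed.

Lemma chi_horner_ge0 t : 0 <= t -> 0 <= chi.[t].
Proof. by move=> t0; apply: le_trans (chi_ge t0); rewrite exprn_ge0. Qed.

Lemma sum_nsq_le : exists2 a, 0 <= a & forall v, \sum_k nsq (A k *m v) <= a * nsq v.
Proof.
have [a a0 ha] := qf_bound (\sum_k (A k)^T *m 1%:M *m A k).
exists a => // v; apply: le_trans (ha v); apply: le_trans (ler_norm _).
by rewrite qf_sum; apply: ler_sum => k _; rewrite qf_conj nsqE.
Qed.

(** If the form at [t] is at least [- c * nsq], then [rform_horner] improves this to
    [- (c / 2) * nsq] as soon as [t + m >= 2 * a]. Iteration pushes the lower bound to 0. *)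
Lemma rform_ge0_large :
  exists2 t0, 0 < t0 & forall t v, t0 <= t -> 0 <= (rform v).[t].
Proof.
have [a a0 ha] := sum_nsq_le.
exists (2 * a + 1) => [|t v ta]; first by lra.
have t0 : 0 < t by lra.
have m0 : (0 : R) < m%:R by rewrite ltr0n.
have [c c0 hc] := qf_bound (map_mx (horner_eval t) resolvent).
have hn n : forall u, - (c / 2 ^+ n * nsq u) <= (rform u).[t].
  elim: n => [|n IH] u.
    by rewrite expr0 divr1 horner_rform; have := hc u; rewrite ler_norml => /andP[].
  have cn0 : 0 <= c / 2 ^+ n by rewrite divr_ge0 // exprn_ge0.
  have h1 : - (c / 2 ^+ n * (a * nsq u)) <= \sum_k (rform (A k *m u)).[t].
    apply: le_trans (ler_sum _ (fun k _ => IH (A k *m u))).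
    by rewrite sumrN lerN2 -mulr_sumr ler_wpM2l.
  have h2 := rform_horner u t.
  have h3 := mulr_ge0 (chi_horner_ge0 (ltW t0)) (nsq_ge0 u).
  have tm0 : 0 < t + m%:R by rewrite addr_gt0.
  rewrite -(ler_pM2l tm0) h2.
  apply: (@le_trans _ _ (- (c / 2 ^+ n * (a * nsq u)))); last by lra.
  rewrite exprS invfM mulrN lerN2 -subr_ge0.
  have -> : (t + m%:R) * (c * (2^-1 * 2 ^- n) * nsq u) - c / 2 ^+ n * (a * nsq u)
     = (c / 2 ^+ n * nsq u) * ((t + m%:R) / 2 - a) by ring.
  apply: mulr_ge0; [exact: mulr_ge0 cn0 (nsq_ge0 u) | lra].
rewrite leNgt; apply/negP => neg.
have cv0 : 0 <= c * nsq v by rewrite mulr_ge0 ?nsq_ge0.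
have := @archi_boundP R (c * nsq v / - (rform v).[t]).
rewrite divr_ge0 ?oppr_ge0 ?(ltW neg) // => /(_ isT).
move: (Num.bound _) => n; rewrite ltr_pdivrMr ?oppr_gt0 // => hlt.
have := hn n v; rewrite mulrAC -mulNr ler_pdivrMr ?exprn_gt0 //.
have h2n : (n%:R : R) <= 2 ^+ n by rewrite -natrX ler_nat ltnW // ltn_expl.
have nr : 0 <= - (rform v).[t] by rewrite oppr_ge0 ltW.
have := ler_wpM2r nr h2n; move: (2 ^+ n) => z h1 h2; lra.
Qed.

Lemma rform_ge0 t v : 0 < t -> 0 <= (rform v).[t].
Proof.
move=> t0; have [M M0 hM] := rform_ge0_large.
have [Mt|/ltW tM] := leP M t; first exact: hM.
have [c c0 hc] := qf_lipschitz resolvent (ltW M0).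
have m0 : (0 : R) < m%:R by rewrite ltr0n.
(* The numerator bounds [chi] from below on [[t, M]], and the denominator bounds [s + m] from above
   for [s] in this interval. *)
pose eps := t ^+ (d * d) / (M + m%:R).
have eps0 : 0 < eps by rewrite divr_gt0 ?exprn_gt0 // addr_gt0.
(* The form is bounded below wherever it is nonnegative, by a constant that is
   uniform on [[t, M]]; hence nonnegativity propagates by steps of fixed size. *)
have low s : t <= s -> s <= M -> (forall u, 0 <= (rform u).[s]) ->
    forall u, eps * nsq u <= (rform u).[s].
  move=> ts sM pos u; have s0 : 0 < s by lra.
  have := rform_horner u s; have : 0 <= \sum_k (rform (A k *m u)).[s].
    by apply: sumr_ge0.
  have := ler_wpM2r (nsq_ge0 u) (chi_ge (ltW s0)).
  have : t ^+ (d * d) * nsq u <= s ^+ (d * d) * nsq u.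
    by rewrite ler_wpM2r ?nsq_ge0 // lerXn2r ?nnegrE ?(ltW t0) ?(ltW s0).
  have : (s + m%:R) * (rform u).[s] <= (M + m%:R) * (rform u).[s].
    by rewrite ler_wpM2r // lerD2r.
  have Mm0 : 0 < M + m%:R by rewrite addr_gt0.
  rewrite /eps mulrAC ler_pdivrMr //; lra.
(* The number of equal steps from [M] down to [t], large enough for the Lipschitz loss [c * h] of
   one step to be at most the margin [eps]. *)
pose n := (Num.bound (c * (M - t) / eps)).+1.
have n0 : (0 : R) < n%:R by rewrite ltr0n.
pose h := (M - t) / n%:R.
have h0 : 0 <= h by rewrite divr_ge0 ?subr_ge0 // ltW.
have hn : h * n%:R = M - t by rewrite divfK // gt_eqF.
have ch : c * h <= eps.
  have : 0 <= c * (M - t) / eps.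
    by apply: divr_ge0; [apply: mulr_ge0; rewrite ?subr_ge0 | exact: ltW].
  move/archi_boundP.
  rewrite ltr_pdivrMr // => hlt.
  rewrite /h mulrA ler_pdivrMr // (le_trans (ltW hlt)) // mulrC ler_wpM2l ?(ltW eps0) //.
  by rewrite ler_nat.
have step k : (k <= n)%N -> forall u, 0 <= (rform u).[M - h * k%:R].
  elim: k => [|k IH] kn u; first by rewrite mulr0 subr0 hM.
  have kn' : (k%:R + 1 : R) <= n%:R by rewrite natr1 ler_nat.
  have k0 : (0 : R) <= k%:R by [].
  have p1 := ler_wpM2l h0 kn'; have p2 := mulr_ge0 h0 k0.
  have := low _ _ _ (IH (ltnW kn)) u.
  rewrite !horner_rform => lo.
  have := hc (M - h * k%:R) (M - h * k.+1%:R) u.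
  have -> : M - h * k%:R - (M - h * k.+1%:R) = h by rewrite -natr1; ring.
  rewrite (ger0_norm h0) -natr1 => lip.
  have {}lo := lo ltac:(lra) ltac:(lra).
  have {}lip := lip ltac:(apply/andP; split; lra) ltac:(apply/andP; split; lra).
  have := ler_wpM2r (nsq_ge0 u) ch; move: lip; rewrite ler_norml => /andP[_ lip].
  lra.
by have := step n (leqnn n) v; rewrite hn opprB addrC subrK.
Qed.

(** [Z] is the coefficient of the resolvent at the least degree [k] where its form does not vanish.
    It dominates near [t = 0], and so inherits the sign of the form at small positive [t]. *)
Lemma subinvariant_exists : exists Z : 'M[R]_d,
  [/\ forall v, 0 <= qf Z v, exists v, qf Z v != 0
    & forall v, \sum_k qf Z (A k *m v) <= m%:R * qf Z v].
Proof.
(* Were the form identically zero, [rformE] at a nonzero vector would make the monic polynomial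
   [chi] vanish. *)
have ex : exists k, `[< exists v, (rform v)`_k != 0 >].
  apply: contrapT => h.
  have r0 v : rform v = 0.
    apply/polyP => k; rewrite coef0; apply: contrapT => /eqP hk.
    by apply: h; exists k; apply/asboolP; exists v.
  pose v : 'cV[R]_d := const_mx 1.
  have := rformE v; rewrite r0 mulr0 big1 ?add0r => [|k _]; last exact: r0.
  move=> /esym/eqP; rewrite mulf_eq0.
  rewrite (negPf (monic_neq0 (char_poly_monic _))) /= polyC_eq0.
  have : 0 < nsq v.
    rewrite /nsq (eq_bigr (fun=> 1)) => [|i _]; last by rewrite mxE expr1n.
    by rewrite sumr_const card_ord ltr0n.
  by move=> /gt_eqF ->.
case: (ex_minnP ex) => k /asboolP [v0 v0k] kmin.
have low j : (j < k)%N -> forall v, (rform v)`_j = 0.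
  move=> jk v; apply: contrapT => /eqP hj.
  by have := kmin j; rewrite leqNgt jk => H; apply/negP/H: isT; apply/asboolP; exists v.
exists (map_mx (coefp k) resolvent); split.
- move=> v; rewrite -coef_rform; apply: low_coef_ge0 => [j jk|t t0].
    exact: low.
  exact: rform_ge0.
- by exists v0; rewrite -coef_rform.
move=> v; rewrite -coef_rform; under eq_bigr => i _ do rewrite -coef_rform.
(* In degree [k] the factor [X] brings in only the coefficient of degree [k - 1], which is 0, and
   the term with [chi] contributes a nonnegative amount. *)
have /(congr1 (fun p : {poly R} => p`_k)) := rformE v.
rewrite mulrDl coefD coefXM -polyC_natr coefCM coefD coef_sum coefMC.
have -> : (if k == 0%N then 0 else (rform v)`_k.-1) = 0.
  by case: (k) low => //= k' low; apply: low.
rewrite add0r => ->; rewrite lerDl mulr_ge0 //; exact: nsq_ge0.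
Qed.

End Resolvent.

(** * Finite semigroups give nonnegative coefficients *)

Section LeftHalfPlane.

Variable C : numClosedFieldType.
Implicit Types p q s : {poly C}.

Lemma coefM_ge0 p q : (forall i, 0 <= p`_i) -> (forall i, 0 <= q`_i) ->
  forall i, 0 <= (p * q)`_i.
Proof. by move=> p0 q0 i; rewrite coefM sumr_ge0 // => j _; rewrite mulr_ge0. Qed.

(** Induction on the degree, removing [X - z] for a real root and [X^2 - 2 Re z X + |z|^2] for a
    pair of conjugate roots. Both have nonnegative coefficients when [Re z <= 0], and products
    preserve this. *)
Lemma real_poly_coef_ge0 p :
  p \is monic -> map_poly Num.conj p = p ->
  (forall z, root p z -> 'Re z <= 0) -> forall i, 0 <= p`_i.
Proof.
have [n] := ubnP (size p); elim: n p => // n IH p szp mp cp rp.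
have [/eqP sz1|sz1] := eqVneq (size p) 1%N.
  have /size_poly1P [c c0 pE] : size p == 1%N by [].
  move: mp; rewrite pE monicE lead_coefC => /eqP -> i.
  by rewrite coefC; case: ifP.
have pn0 := monic_neq0 mp.
have [z rz] := closed_rootP p sz1.
have peel s q : s \is monic -> (1 < size s)%N ->
    map_poly Num.conj s = s -> (forall i, 0 <= s`_i) -> p = q * s ->
    forall i, 0 <= p`_i.
  move=> ms sz cs ns pE; rewrite pE; apply: coefM_ge0 => //.
  have mq : q \is monic by move: mp; rewrite pE monicMr.
  apply: IH => //.
  - rewrite -ltnS; apply: leq_trans szp; rewrite pE size_Mmonic ?monic_neq0 //.
    by have := monic_neq0 mq; rewrite -size_poly_gt0; lia.
  - apply: (mulIf (monic_neq0 ms)); rewrite -[in LHS]cs -rmorphM /= -pE; exact: cp.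
  by move=> w rw; apply: rp; rewrite pE rootM rw.
have rzc : root p (z^*)%C.
  by rewrite -cp /root horner_map /= (rootP rz) rmorph0.
have [zr|zr] := boolP (z \is Num.real).
  have /factor_theorem [q pE] := rz.
  apply: peel pE; rewrite ?monicXsubC ?size_XsubC //.
    by rewrite rmorphB /= map_polyX map_polyC /= conj_Creal.
  have := rp z rz; rewrite (Creal_ReP _ zr) => z0 i.
  rewrite coefB coefX coefC; case: i => [|i] /=; first by rewrite sub0r oppr_ge0.
  by rewrite subr0 ler0n.
have zzc : z != (z^*)%C by apply: contra zr => /eqP zE; apply/CrealP.
have [q pE] : exists q, p = q * ('X ^+ 2 - ('Re z *+ 2) *: 'X + (`|z| ^+ 2)%:P).
  have /factor_theorem [q pE] := rz.
  have : root q (z^*)%C.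
    by have := rzc; rewrite {1}pE rootM root_XsubC eq_sym (negPf zzc) orbF.
  case/factor_theorem=> q' qE; exists q'; rewrite pE qE -mulrA; congr (_ * _).
  rewrite normCK (_ : 'Re z *+ 2 = z + (z^*)%C).
    by rewrite scalerDl -!mul_polyC polyCM; ring.
  by rewrite ReE -mulr_natr divfK ?pnatr_eq0.
have sE : size ('X ^+ 2 - ('Re z *+ 2) *: 'X + (`|z| ^+ 2)%:P : {poly C}) = 3%N.
  rewrite -addrA size_polyDl ?size_polyXn //.
  rewrite ltnS (leq_trans (size_polyD _ _)) // geq_max size_polyN.
  rewrite (leq_trans (size_scale_leq _ _)) ?size_polyX //.
  by rewrite (leq_trans (size_polyC_leq1 _)).
apply: (peel _ q _ _ _ _ pE).
- by rewrite monicE lead_coefE sE !coefE /= mulr0 subr0 addr0.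
- by rewrite sE.
- rewrite rmorphD rmorphB /= map_polyXn map_polyZ map_polyX map_polyC /=.
  by rewrite rmorphMn /= !conj_Creal ?Creal_Re // rpredX // normr_real.
move=> i; rewrite !coefE; case: i => [|[|[|i]]] /=.
- by rewrite mulr0 subr0 add0r exprn_ge0.
- by rewrite mulr1 sub0r addr0 oppr_ge0 mulrn_wle0 // rp.
- by rewrite mulr0 subr0 addr0 ler01.
by rewrite mulr0 subr0 addr0.
Qed.

End LeftHalfPlane.

(** * The spectrum of the averaging operator of a finite semigroup *)

Section FiniteCoef.

Variables (d m : nat) (A : 'I_m -> 'M[int]_d).
Hypothesis m_gt0 : (0 < m)%N.
Hypothesis finA : finite_set (generated_semigroup A).

Local Notation toC B := (map_mx (intr : int -> algC) B).

Lemma word_product_bounded :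
  exists c : nat, forall s i j, (`|word_product A s i j| <= c)%N.
Proof.
have [D DE] := (finite_seqP (generated_semigroup A)).1 finA.
(* The 1 accounts for the empty word, whose product need not belong to the semigroup. *)
exists (1 + \sum_(B <- D) \sum_(ij : 'I_d * 'I_d) `|B ij.1 ij.2|)%N => s i j.
case: s => [|k s].
  rewrite /word_product big_nil mxE; case: (i == j) => //=.
have : generated_semigroup A (word_product A (k :: s)) by exists (k :: s).
rewrite DE /= => inD; rewrite (big_rem _ inD) /= (bigD1 (i, j)) //=; lia.
Qed.

(** Applying the eigenvalue equation [n] times writes [mu ^+ n *: Y] as a sum of [m ^ n] matrices
    [X s], whose entries are all bounded by [b]. So [|mu| ^ n] grows no faster than [m ^ n]. *)
Lemma eigenvalue_kron_le (mu : algC) (Y : 'M[algC]_d) : Y != 0 ->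
  \sum_k (toC (A k))^T *m Y *m toC (A k) = mu *: Y -> `|mu| <= m%:R.
Proof.
move=> Y0 YE; have [c hc] := word_product_bounded.
pose X s := (toC (word_product A s))^T *m Y *m toC (word_product A s).
pose b := \sum_i \sum_j c%:R * `|Y i j| * c%:R.
have Xb s i j : `|X s i j| <= b.
  have wc a a' : `|toC (word_product A s) a a'| <= c%:R.
    by rewrite mxE -intr_norm -natr_absz ler_nat.
  rewrite mxE; under eq_bigr => a _ do rewrite mxE mulr_suml.
  rewrite exchange_big /= (le_trans (ler_norm_sum _ _ _)) //; apply: ler_sum => a _.
  rewrite (le_trans (ler_norm_sum _ _ _)) //; apply: ler_sum => a' _.
  rewrite !normrM; apply: ler_pM => //; first by rewrite mulr_ge0.
  by apply: ler_pM => //; rewrite mxE.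
have Xstep s : mu *: X s = \sum_k X (k :: s).
  rewrite /X scalemxAl scalemxAr -YE mulmx_sumr mulmx_suml.
  by apply: eq_bigr => k _; rewrite word_product_cons map_mxM trmx_mul !mulmxA.
have growth n : forall s i j, `|mu| ^+ n * `|X s i j| <= m%:R ^+ n * b.
  elim: n => [|n IH] s i j; first by rewrite !expr0 !mul1r.
  rewrite exprSr -mulrA -normrM.
  have -> : mu * X s i j = \sum_k X (k :: s) i j.
    by rewrite -summxE -Xstep [RHS]mxE.
  apply: le_trans (ler_wpM2l (exprn_ge0 _ (normr_ge0 _)) (ler_norm_sum _ _ _)) _.
  rewrite mulr_sumr (le_trans (ler_sum _ (fun k _ => IH (k :: s) i j))) //.
  by rewrite sumr_const card_ord exprSr -mulrA mulr_natl mulrnAr.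
have [i [j Yij]] : exists i j, Y i j != 0.
  apply: contrapT => h; case/eqP: Y0; apply/matrixP => i j; rewrite mxE.
  by apply: contrapT => /eqP Yij; apply: h; exists i, j.
have {growth} growth n : `|mu| ^+ n * `|Y i j| <= m%:R ^+ n * b.
  have := growth n [::] i j.
  by rewrite /X /word_product big_nil map_mx1 trmx1 mul1mx mulmx1.
rewrite real_leNgt ?num_real // ?ger0_real //; apply/negP => mmu.
have m0 : (0 : algC) < m%:R by rewrite ltr0n.
pose e := `|mu| / m%:R - 1.
have e0 : 0 < e by rewrite subr_gt0 ltr_pdivlMr ?mul1r.
have muE : `|mu| = m%:R * (1 + e) by rewrite addrC subrK mulrC divfK ?gt_eqF.
(* Bernoulli's inequality, by which [(|mu| / m) ^+ n] would exceed every bound. *)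
have bern n : 1 + e *+ n <= (1 + e) ^+ n.
  elim: n => [|n IH]; first by rewrite mulr0n addr0.
  have e1 : 0 <= 1 + e by rewrite addr_ge0 ?ltW.
  rewrite exprS; apply: le_trans (ler_wpM2l e1 IH).
  have -> : (1 + e) * (1 + e *+ n) = 1 + e *+ n.+1 + e * (e *+ n).
    by rewrite mulrS; ring.
  by rewrite lerDl mulr_ge0 ?mulrn_wge0 // ltW.
have Y0' : 0 < `|Y i j| by rewrite normr_gt0.
have b0 : 0 <= b by apply: le_trans (Xb [::] i j).
have := @archi_boundP algC (b / (e * `|Y i j|)).
rewrite divr_ge0 ?mulr_ge0 ?(ltW e0) // => /(_ isT); move: (Num.bound _) => n.
rewrite ltr_pdivrMr ?mulr_gt0 // => hlt.
have := growth n; rewrite muE exprMn -mulrA ler_pM2l ?exprn_gt0 //.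
move=> le_b; suff : b < b by rewrite ltxx.
apply: lt_le_trans hlt _; apply: le_trans le_b; rewrite mulrA ler_wpM2r //.
by apply: le_trans (bern n); rewrite mulr_natl lerDr; apply: ler01.
Qed.

(** An eigenvalue [z] of the test matrix gives the eigenvalue [z + m] of [Phi], so [|z + m| <= m]
    and the real part of [z] is at most 0. The algebraic numbers contain all these eigenvalues. *)
Lemma finite_coef_ge0 i : 0 <= (char_poly (test_mx A))`_i.
Proof.
rewrite -(ler_int algC) /= -[_%:~R]/((intr : int -> algC) _).
rewrite -coef_map /= map_char_poly map_test_mx.
apply: real_poly_coef_ge0; first exact: char_poly_monic.
  rewrite map_char_poly map_test_mx; congr (char_poly (test_mx _)).
  apply/funext => k; apply/matrixP => a b; rewrite !mxE.
  by rewrite /= conj_Creal // realz.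
move=> z; rewrite -eigenvalue_root_char => /eigenvalueP [v vE v0].
have : `|z + m%:R| <= m%:R.
  apply: (@eigenvalue_kron_le _ (unrow v)).
    apply: contraNneq v0 => h; apply/eqP/unrow_inj; rewrite h.
    by apply/matrixP => a b; rewrite !mxE.
  have vkron : v *m kron (fun k => toC (A k)) = (z + m%:R) *: v.
    by rewrite scalerDl -vE mulmxBr mul_mx_scalar subrK.
  rewrite -(unrow_kron (fun k => toC (A k))) vkron.
  by apply/matrixP => a b; rewrite !mxE.
move=> zm; have [h _] := leif_normC_Re_Creal (z + m%:R).
have := real_ler_normlW (Creal_Re _) (le_trans h zm).
by rewrite raddfD /= (Creal_ReP _ (realn _ _)) gerDr.
Qed.

End FiniteCoef.

Lemma finite_semigroup_fl_coef (R : realType) d m (A : 'I_m -> 'M[int]_d) :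
  (0 < d)%N -> (0 < m)%N -> irreducible A R -> non_mortal A ->
  finite_set (generated_semigroup A) <->
  forall k, (k < d * d)%N -> 0 <= fl_coef (test_mx A) k.
Proof.
move=> d0 m0 irrA nmA; rewrite -char_poly_coef_ge0; split=> [finA i|chi0].
  exact: finite_coef_ge0.
pose AR k := map_mx (intr : int -> R) (A k).
have [|Z [Z0 Zn Zs]] := @subinvariant_exists R d m AR d0 m0.
  by move=> i; rewrite -map_test_mx -map_char_poly coef_map /= ler0z.
exact: (finite_of_subinvariant m0 irrA nmA Z0 Zn Zs).
Qed.

(** * Evaluation of expressions with size control *)

Section Evaluation.

Variable B : nat.

(** Value and size conditions are paired, so that both are derived together along the syntax. *)
Definition ev (s : state) (e : expr) (z : int) := bounded B s e /\ eval s e = z.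

Lemma ev_lit s c : ev s (Lit c) c.
Proof. by []. Qed.

Lemma ev_var s x z : getv s x = z -> (`|z| < 2 ^ B)%N -> ev s (Var x) z.
Proof. by move=> <- zB; split. Qed.

Lemma ev_bin s o e1 e2 x y z : ev s e1 x -> ev s e2 y -> eval_arith o x y = z ->
  (`|z| < 2 ^ B)%N -> ev s (Bin o e1 e2) z.
Proof. by case=> b1 E1 [b2 E2] E zB; split; rewrite /= E1 E2 E. Qed.

Lemma ev_arr s a e (n : nat) z : ev s e n -> (8 * n + 8 < 2 ^ B)%N ->
  geta s a n = z -> (`|z| < 2 ^ B)%N -> ev s (Arr a e) z.
Proof. by case=> b1 E1 nB E zB; rewrite /ev /= E1 /= E; do 2! split. Qed.

Lemma ev_add s e1 e2 x y : ev s e1 x -> ev s e2 y -> (`|(x + y)%R| < 2 ^ B)%N ->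
  ev s (Bin Plus e1 e2) (x + y).
Proof. by move=> h1 h2; apply: (ev_bin h1 h2). Qed.

Lemma ev_sub s e1 e2 x y : ev s e1 x -> ev s e2 y -> (`|(x - y)%R| < 2 ^ B)%N ->
  ev s (Bin Minus e1 e2) (x - y).
Proof. by move=> h1 h2; apply: (ev_bin h1 h2). Qed.

Lemma ev_mul s e1 e2 x y : ev s e1 x -> ev s e2 y -> (`|(x * y)%R| < 2 ^ B)%N ->
  ev s (Bin Times e1 e2) (x * y).
Proof. by move=> h1 h2; apply: (ev_bin h1 h2). Qed.

Lemma ev_addn s e1 e2 (a b : nat) : ev s e1 a -> ev s e2 b -> (a + b < 2 ^ B)%N ->
  ev s (Bin Plus e1 e2) (a + b)%N.
Proof. by move=> h1 h2 h; apply: (ev_bin h1 h2). Qed.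

Lemma ev_muln s e1 e2 (a b : nat) : ev s e1 a -> ev s e2 b -> (a * b < 2 ^ B)%N ->
  ev s (Bin Times e1 e2) (a * b)%N.
Proof. by move=> h1 h2 h; apply: (ev_bin h1 h2) => //=; rewrite PoszM. Qed.

Lemma ev_divn s e1 e2 (a b : nat) : ev s e1 a -> ev s e2 b -> (a < 2 ^ B)%N ->
  ev s (Bin Defs.Quotient e1 e2) (a %/ b)%N.
Proof.
move=> h1 h2 h; apply: ev_bin h1 h2 _ _; first by rewrite /= divz_nat.
by apply: leq_ltn_trans h; apply: leq_div.
Qed.

Definition Mod e1 e2 := Bin Minus e1 (Bin Times (Bin Defs.Quotient e1 e2) e2).

Lemma ev_modn s e1 e2 (a b : nat) : ev s e1 a -> ev s e2 b -> (a < 2 ^ B)%N ->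
  ev s (Mod e1 e2) (a %% b)%N.
Proof.
move=> h1 h2 h; apply: (ev_bin h1 (ev_muln (ev_divn h1 h2 h) h2 _)).
- by apply: leq_ltn_trans h; apply: leq_trunc_div.
- by rewrite /= {1}(divn_eq a b) PoszD addrC addKr.
by apply: leq_ltn_trans h; apply: leq_mod.
Qed.

(* The Kronecker symbol: 1 / (1 + (x - y)^2) has integer part [x = y]. *)
Definition Delta e1 e2 :=
  Bin Defs.Quotient (Lit 1)
    (Bin Plus (Lit 1) (Bin Times (Bin Minus e1 e2) (Bin Minus e1 e2))).

Lemma ev_delta s e1 e2 (a b c : nat) : ev s e1 a -> ev s e2 b ->
  (a <= c)%N -> (b <= c)%N -> (1 + c * c < 2 ^ B)%N ->
  ev s (Delta e1 e2) (a == b)%N.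
Proof.
move=> h1 h2 ac bc cB.
have u : (`|a%:Z - b%:Z| <= c)%N by lia.
have uu : (`|((a%:Z - b%:Z) * (a%:Z - b%:Z))%R| <= c * c)%N by rewrite abszM leq_mul.
have cc : (c < 2 ^ B)%N by case: (c) cB => [|c']; nia.
have hd : ev s (Bin Minus e1 e2) (a%:Z - b%:Z) by apply: (ev_bin h1 h2 erefl) => /=; lia.
have hq : ev s (Bin Times (Bin Minus e1 e2) (Bin Minus e1 e2))
               ((a%:Z - b%:Z) * (a%:Z - b%:Z)).
  by apply: (ev_bin hd hd erefl) => /=; lia.
have q0 : 0 <= (a%:Z - b%:Z) * (a%:Z - b%:Z) by rewrite -expr2 sqr_ge0.
have qab : ((a%:Z - b%:Z) * (a%:Z - b%:Z) == 0) = (a == b).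
  by rewrite mulf_eq0 orbb subr_eq0.
move: hq uu q0 qab; move: (_ * _) => q hq uu q0 <-.
have hp : ev s (Bin Plus (Lit 1) (Bin Times (Bin Minus e1 e2) (Bin Minus e1 e2))) (1 + q).
  by apply: (ev_bin (ev_lit s 1) hq erefl) => /=; lia.
apply: ev_bin (ev_lit s 1) hp _ _ => /=.
  case: eqP => [->|qn]; first by rewrite addr0.
  by rewrite divz_small //; apply/andP; split; lia.
by case: (q == 0) => /=; lia.
Qed.

(* The indicator of nonnegativity: 1 + z / (z^2 + 1), Euclidean division. *)
Definition Nonneg e :=
  Bin Plus (Lit 1) (Bin Defs.Quotient e (Bin Plus (Bin Times e e) (Lit 1))).

Lemma ev_nonneg s e z : ev s e z -> (`|z| ^ 2 + 1 < 2 ^ B)%N ->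
  ev s (Nonneg e) (0 <= z)%R.
Proof.
move=> h zB.
have zz : (`|(z * z)%R| = `|z| ^ 2)%N by rewrite abszM.
have zB' : (`|z| < 2 ^ B)%N by apply: leq_ltn_trans zB; nia.
have z20 : 0 <= z * z by rewrite -expr2 sqr_ge0.
have zlt : z < 0 -> - z <= z * z by move=> z0; nia.
have zge : 0 <= z -> z <= z * z by move=> z0; nia.
have h2 : ev s (Bin Times e e) (z * z).
  by apply: (ev_bin h h erefl) => /=; rewrite zz; lia.
have hp : ev s (Bin Plus (Bin Times e e) (Lit 1)) (z * z + 1).
  by apply: (ev_bin h2 (ev_lit s 1) erefl) => /=; lia.
have q : (z %/ (z * z + 1))%Z = (0 <= z)%R%:Z - 1.
  case: (leP 0 z) => z0.
    by rewrite subrr divz_small //; apply/andP; have := zge z0; lia.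
  (* For [z < 0] the Euclidean quotient is -1, with this nonnegative remainder. *)
  have {1}-> : z = (-1) * (z * z + 1) + (z * z + z + 1) by ring.
  rewrite divzMDl; last by lia.
  by rewrite divz_small // ?addr0 //; apply/andP; have := zlt z0; lia.
have hq : ev s (Bin Defs.Quotient e (Bin Plus (Bin Times e e) (Lit 1)))
               ((0 <= z)%R%:Z - 1).
  by apply: (ev_bin (o := Defs.Quotient) h hp q); case: (0 <= z)%R => /=; lia.
by apply: (ev_bin (ev_lit s 1) hq) => /=; case: (0 <= z)%R => /=; lia.
Qed.

Hypothesis B_ge8 : (8 <= B)%N.

Lemma runs_le c s s' T T' : (T <= T')%N -> runs B c s s' T -> runs B c s s' T'.
Proof.
move=> TT h P off M w hP sM; have [M' [w' [t [ht sM' tB]]]] := h P off M w hP sM.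
by exists M', w', t; split=> //; apply: leq_trans tB _; rewrite leq_mul2r TT orbT.
Qed.

Lemma run_assign x e s s' z T : ev s e z -> setv s x z = s' ->
  (x < 16)%N && small_expr 0 e -> (size (compile_expr 0 e) + 2 <= T)%N ->
  runs B (Assign x e) s s' T.
Proof.
by case=> be <- <- /andP[x16 se] TT; apply: runs_le TT _; apply: runs_assign.
Qed.

Lemma run_input x s s' z w T : inp s = z :: w -> St (vars (setv s x z)) (arrs s) w = s' ->
  (x < 16)%N -> (`|z| < 2 ^ B)%N -> (0 < T)%N -> runs B (Input x) s s' T.
Proof.
move=> sw <- x16 zB TT; apply: runs_le TT _.
by have := @runs_input B B_ge8 x s x16; rewrite sw; apply.
Qed.

Lemma run_store a e1 e2 s s' (n : nat) z T : ev s e1 n -> ev s e2 z ->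
  seta s a n z = s' -> (8 * n + 8 < 2 ^ B)%N ->
  [&& (a < 6)%N, small_expr 1 e1 & small_expr 0 e2] ->
  (size (compile_expr 0 e2) + size (compile_expr 1 e1) + 5 <= T)%N ->
  runs B (Store a e1 e2) s s' T.
Proof.
case=> b1 E1 [b2 <-] <- nB /and3P[a6 s1 s2] TT; apply: runs_le TT _.
by have := @runs_store B B_ge8 a e1 e2 s; rewrite E1 /=; apply.
Qed.

(** Resetting the counter gives the states before and after a loop the same shape. *)
Definition Loop x n c := Seq (For x n c) (Assign x (Lit 0)).

(** The 7 is the 4 of [runs_for] plus the three instructions of the reset. *)
Lemma run_loop x n c (s s' : nat -> state) s0 s1 (k : nat) T :
  (x < 16)%N && (n < 16)%N -> (k < 2 ^ B)%N ->
  s0 = s 0%N -> setv (s 0%N) x 0 = s 0%N -> setv (s k) x 0 = s1 ->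
  (forall j, (j <= k)%N -> getv (s j) n = k /\ getv (s j) x = j) ->
  (forall j, (j < k)%N -> runs B c (s j) (s' j) T) ->
  (forall j, (j < k)%N -> getv (s' j) x = j /\ setv (s' j) x j.+1 = s j.+1) ->
  runs B (Loop x n c) s0 s1 (k * (T + 5) + 7).
Proof.
move=> /andP[x16 n16] kB -> sE <- sk hc hs.
have -> : (k * (T + 5) + 7 = k * (T + 5) + 4 + 3)%N by lia.
apply: runs_seq.
  apply: (runs_for (s' := s') B_ge8 x16 n16 kB sE sk) => j jk.
  by have [h1 h2] := hs j jk; split=> //; apply: hc.
by apply: run_assign; [exact: ev_lit | by [] | rewrite x16 | ].
Qed.

End Evaluation.

(** * Matrices as arrays *)

Definition mxseq r c (M : 'M[int]_(r, c)) : seq int :=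
  [seq M i j | i <- enum 'I_r, j <- enum 'I_c].

(** The content of an array holding [M], in the order of [encode]. The default 0 agrees with the
    untouched registers beyond the matrix. *)
Definition mxf n (M : 'M[int]_n) (x : nat) : int := nth 0 (mxseq M) x.

Lemma size_mxseq n (M : 'M[int]_n) : size (mxseq M) = (n * n)%N.
Proof. by rewrite size_allpairs !size_enum_ord. Qed.

Lemma mxf_ge n (M : 'M[int]_n) x : (n * n <= x)%N -> mxf M x = 0.
Proof. by move=> h; rewrite /mxf nth_default // size_mxseq. Qed.

Lemma nth_allpairs_enum (T S R : Type) (f : T -> S -> R) x0 y0 z0
    (s : seq T) (t : seq S) i j : (i < size s)%N -> (j < size t)%N ->
  nth z0 [seq f x y | x <- s, y <- t] (i * size t + j) = f (nth x0 s i) (nth y0 t j).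
Proof.
elim: s i => // x s IH [|i] /= is_ jt; rewrite nth_cat size_map.
  by rewrite mul0n jt (nth_map y0).
by rewrite mulSn -addnA ltnNge leq_addr /= addKn IH.
Qed.

Lemma mxfE n (M : 'M[int]_n) (i j : 'I_n) : mxf M (i * n + j) = M i j.
Proof.
have sz : size (enum 'I_n) = n by rewrite size_enum_ord.
have := @nth_allpairs_enum _ _ _ (fun i j => M i j) i j 0 (enum 'I_n) (enum 'I_n) i j.
by rewrite sz => /(_ (ltn_ord i) (ltn_ord j)); rewrite !nth_ord_enum.
Qed.

Lemma mxf_divmod n (M : 'M[int]_n) x (lt_x : (x < n * n)%N) :
  mxf M x = M (hi (Ordinal lt_x)) (lo (Ordinal lt_x)).
Proof. by rewrite {1}(divn_eq x n) (mxfE M (hi (Ordinal lt_x)) (lo (Ordinal lt_x))). Qed.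

Lemma mxf_norm n (M : 'M[int]_n) (c : nat) x :
  (forall i j, (`|M i j| <= c)%N) -> (`|mxf M x| <= c)%N.
Proof.
move=> Mc; case: (ltnP x (n * n)) => [lt_x|/mxf_ge ->] //.
by rewrite mxf_divmod.
Qed.

Lemma mxf0 n : mxf (0 : 'M[int]_n) = fun=> 0.
Proof.
apply/funext => x; case: (ltnP x (n * n)) => [lt_x|/mxf_ge -> //].
by rewrite mxf_divmod mxE.
Qed.

(** An array in the course of a loop that overwrites [g] by [f], with [p] cells done. *)
Definition cutf (p : nat) (f g : nat -> int) : nat -> int :=
  fun x => if (x < p)%N then f x else g x.

Lemma cutf0 f g : cutf 0 f g = g.
Proof. by []. Qed.

Lemma cutf_step p f g v : f p = v ->
  (fun x => if x == p then v else cutf p f g x) = cutf p.+1 f g.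
Proof.
move=> <-; apply/funext => x.
by rewrite /cutf [(x < p.+1)%N]ltnS [(x <= p)%N]leq_eqVlt; case: eqP => [->|].
Qed.

Lemma cutf_mxf n (M M' : 'M[int]_n) : cutf (n * n) (mxf M) (mxf M') = mxf M.
Proof.
by apply/funext => x; rewrite /cutf; case: ltnP => // nx; rewrite !mxf_ge.
Qed.

Lemma cutf_ge p f g : cutf p f g p = g p.
Proof. by rewrite /cutf ltnn. Qed.

(** * The program *)

(* Variables: 0 answer, 1 d, 2 m, 3 d^2, 4 d^4, 5 outer counter, 6 trace,
   7 position in a matrix of size d^2, 8 summation index, 9 accumulator.
   Arrays: 0 current input matrix, 1 test matrix, 2 Faddeev-LeVerrier matrix,
   3 product of the latter two. *)
Definition Row := Bin Defs.Quotient (Var 7) (Var 3).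
Definition Col := Mod (Var 7) (Var 3).
Definition Entry i j := Arr 0 (Bin Plus (Bin Times i (Var 1)) j).

Definition read_loop :=
  Loop 7 3 (Seq (Input 9) (Seq (Store 0 (Var 7) (Var 9)) (Assign 9 (Lit 0)))).

Definition kron_loop :=
  Loop 7 4 (Store 1 (Var 7) (Bin Plus (Arr 1 (Var 7))
    (Bin Times (Entry (Bin Defs.Quotient Row (Var 1)) (Bin Defs.Quotient Col (Var 1)))
               (Entry (Mod Row (Var 1)) (Mod Col (Var 1)))))).

Definition shift_loop :=
  Loop 7 4 (Seq
    (Store 1 (Var 7) (Bin Minus (Arr 1 (Var 7)) (Bin Times (Var 2) (Delta Row Col))))
    (Store 2 (Var 7) (Delta Row Col))).

Definition mul_loop :=
  Loop 7 4 (Seq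
    (Loop 8 3 (Assign 9 (Bin Plus (Var 9)
       (Bin Times (Arr 1 (Bin Plus (Bin Times Row (Var 3)) (Var 8)))
                  (Arr 2 (Bin Plus (Bin Times (Var 8) (Var 3)) Col))))))
    (Seq (Store 3 (Var 7) (Var 9)) (Assign 9 (Lit 0)))).

Definition trace_loop :=
  Loop 7 3 (Assign 6 (Bin Minus (Var 6)
    (Arr 3 (Bin Plus (Bin Times (Var 7) (Var 3)) (Var 7))))).

Definition update_loop :=
  Loop 7 4 (Store 2 (Var 7) (Bin Plus
    (Bin Times (Bin Plus (Var 5) (Lit 1)) (Arr 3 (Var 7)))
    (Bin Times (Var 6) (Delta Row Col)))).

Definition fl_step :=
  Seq mul_loop (Seq trace_loop (Seq update_loop
    (Seq (Assign 0 (Bin Times (Var 0) (Nonneg (Var 6)))) (Assign 6 (Lit 0))))).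

Definition decide :=
  Seq (Input 1) (Seq (Input 2)
    (Seq (Assign 3 (Bin Times (Var 1) (Var 1)))
    (Seq (Assign 4 (Bin Times (Var 3) (Var 3)))
    (Seq (Loop 5 2 (Seq read_loop kron_loop))
    (Seq shift_loop
    (Seq (Assign 0 (Lit 1)) (Loop 5 3 fl_step))))))).

Definition kron1 d (M : 'M[int]_d) : 'M[int]_(d * d) :=
  \matrix_(p, q) (M (hi p) (hi q) * M (lo p) (lo q)).

Lemma norm_sum_le (c : nat) (F : nat -> int) j :
  (forall l, (`|F l| <= c)%N) -> (`|(\sum_(0 <= l < j) F l)%R| <= j * c)%N.
Proof.
move=> Fc; elim: j => [|j IH]; first by rewrite big_geq.
by rewrite big_nat_recr //=; have := Fc j; move: (\sum_(_ <= _ < _) _) IH; lia.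
Qed.

(** * Correctness of the inner loops *)

Section Run.

Variables (d m B : nat).
Hypothesis B_ge8 : (8 <= B)%N.
Hypothesis d_gt0 : (0 < d)%N.

Local Notation N := (d * d)%N.
Local Notation Q := (N * N)%N.

Hypothesis QB : (8 * Q + 8 < 2 ^ B)%N.
Hypothesis mB : (m < 2 ^ B)%N.

Lemma leNQ : (N <= Q)%N.
Proof. by rewrite leq_pmulr // muln_gt0 d_gt0. Qed.

Lemma le_dN : (d <= N)%N.
Proof. by rewrite leq_pmulr. Qed.

Definition mk (f k : nat) (D : int) (p l : nat) (acc : int) a0 a1 a2 a3 w : state :=
  St [:: f%:Z; d%:Z; m%:Z; N%:Z; Q%:Z; k%:Z; D; p%:Z; l%:Z; acc] [:: a0; a1; a2; a3] w.

Ltac nat_bound := have := leNQ; have := le_dN; lia.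

(** The 95 instructions allowed per turn, like the round figures of the next lemmas, are a generous
    bound on the length of the compiled body. *)
Lemma run_read f k D (M0 M : 'M[int]_d) a1 a2 a3 w :
  (forall i j, (`|M i j| < 2 ^ B)%N) ->
  runs B read_loop (mk f k D 0 0 0 (mxf M0) a1 a2 a3 (mxseq M ++ w))
                   (mk f k D 0 0 0 (mxf M) a1 a2 a3 w) (N * 100 + 7).
Proof.
move=> MB.
have mB' x : (`|mxf M x| < 2 ^ B)%N.
  by case: (ltnP x N) => [lt_x|/mxf_ge ->]; rewrite ?mxf_divmod // expn_gt0.
pose s j := mk f k D j 0 0 (cutf j (mxf M) (mxf M0)) a1 a2 a3 (drop j (mxseq M) ++ w).
pose s' j :=
  mk f k D j 0 0 (cutf j.+1 (mxf M) (mxf M0)) a1 a2 a3 (drop j.+1 (mxseq M) ++ w).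
apply: (@run_loop B B_ge8 7 3 _ s s' _ _ N 95) => //; first by nat_bound.
- by rewrite /s cutf0 drop0.
- by rewrite /s cutf_mxf drop_oversize ?size_mxseq.
move=> j jN; have tE : drop j (mxseq M) ++ w = mxf M j :: (drop j.+1 (mxseq M) ++ w).
  by rewrite (drop_nth 0) ?size_mxseq.
rewrite /s tE; apply: (runs_seq (T1 := 1) (T2 := 94)).
  by apply: (run_input B_ge8); [by [] | reflexivity | by [] | exact: mB' | by []].
apply: (runs_seq (T1 := 50) (T2 := 44)).
  apply: (run_store B_ge8 (n := j) (z := mxf M j)); try by [].
  - by apply: ev_var => //=; nat_bound.
  - by apply: ev_var => //=; exact: mB'.
  by nat_bound.
apply: (run_assign B_ge8); [exact: ev_lit | | by [] | by []].
by rewrite /= /setv /seta /= /geta /= cutf_step.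
Qed.

Section InState.

Variables (f k : nat) (D : int) (x l : nat) (acc : int).
Variables (a0 a1 a2 a3 : nat -> int) (w : seq int).
Hypothesis xQ : (x < Q)%N.

Let s := mk f k D x l acc a0 a1 a2 a3 w.

Lemma row_lt : (x %/ N < N)%N.
Proof. by rewrite ltn_divLR // muln_gt0 d_gt0. Qed.

Lemma col_lt : (x %% N < N)%N.
Proof. by rewrite ltn_mod muln_gt0 d_gt0. Qed.

Lemma ev_pos : ev B s (Var 7) x.
Proof. by apply: ev_var => //=; nat_bound. Qed.

Lemma ev_d : ev B s (Var 1) d.
Proof. by apply: ev_var => //=; nat_bound. Qed.

Lemma ev_N : ev B s (Var 3) N.
Proof. by apply: ev_var => //=; nat_bound. Qed.

Lemma ev_row : ev B s Row (x %/ N)%N.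
Proof. by apply: ev_divn ev_pos ev_N _; nat_bound. Qed.

Lemma ev_col : ev B s Col (x %% N)%N.
Proof. by apply: ev_modn ev_pos ev_N _; nat_bound. Qed.

Lemma ev_diag : ev B s (Delta Row Col) (x %/ N == x %% N)%N.
Proof.
apply: (ev_delta ev_row ev_col (c := N.-1)); have := row_lt; have := col_lt.
- lia.
- lia.
have : (N.-1 * N.-1 <= Q)%N by rewrite leq_mul ?leq_pred.
have := leNQ; have := le_dN; lia.
Qed.

Lemma ev_entry e1 e2 (i j : nat) (M : 'M[int]_d) : a0 = mxf M ->
  (forall i j, (`|M i j| < 2 ^ B)%N) -> (i < d)%N -> (j < d)%N ->
  ev B s e1 i -> ev B s e2 j -> ev B s (Entry e1 e2) (mxf M (i * d + j)).
Proof.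
move=> a0E MB id' jd h1 h2.
have lt_ij : (i * d + j < N)%N by nia.
apply: (ev_arr (n := (i * d + j)%N)); last first.
- by rewrite (mxfE M (Ordinal id') (Ordinal jd)).
- by rewrite /geta /= a0E.
- by nat_bound.
apply: ev_addn (ev_muln h1 ev_d _) h2 _; nat_bound.
Qed.

End InState.

Lemma run_kron f k D (M : 'M[int]_d) (K0 : 'M[int]_N) a2 a3 w :
  (forall i j, (`|M i j| < 2 ^ B)%N) ->
  (forall i j, (`|K0 i j| < 2 ^ B)%N) ->
  (forall i j, (`|kron1 M i j| < 2 ^ B)%N) ->
  (forall i j, (`|(K0 + kron1 M)%R i j| < 2 ^ B)%N) ->
  runs B kron_loop (mk f k D 0 0 0 (mxf M) (mxf K0) a2 a3 w)
                   (mk f k D 0 0 0 (mxf M) (mxf (K0 + kron1 M)) a2 a3 w)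
       (Q * 200 + 7).
Proof.
move=> MB K0B kB KB.
pose s j := mk f k D j 0 0 (mxf M) (cutf j (mxf (K0 + kron1 M)) (mxf K0)) a2 a3 w.
pose s' j := mk f k D j 0 0 (mxf M) (cutf j.+1 (mxf (K0 + kron1 M)) (mxf K0)) a2 a3 w.
apply: (@run_loop B B_ge8 7 4 _ s s' _ _ Q 195) => //; first by nat_bound.
  by rewrite /s cutf_mxf.
move=> x xQ; have [rN cN] := (row_lt xQ, col_lt x).
pose X := Ordinal xQ.
have rd : (x %/ N %/ d < d)%N by rewrite ltn_divLR.
have cd : (x %% N %/ d < d)%N by rewrite ltn_divLR.
have rd' : (x %/ N %% d < d)%N by rewrite ltn_mod.
have cd' : (x %% N %% d < d)%N by rewrite ltn_mod.
(* [v1] is taken at the quotients by [d] of the row and column indices, [v2] at the remainders: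
   these are the two factors of a Kronecker entry. *)
pose v1 := mxf M (x %/ N %/ d * d + x %% N %/ d).
pose v2 := mxf M (x %/ N %% d * d + x %% N %% d).
have v12 : v1 * v2 = kron1 M (hi X) (lo X).
  rewrite mxE; congr (_ * _).
    exact: (mxfE M (hi (hi X)) (hi (lo X))).
  exact: (mxfE M (lo (hi X)) (lo (lo X))).
apply: (run_store B_ge8 (n := x) (z := mxf K0 x + v1 * v2)); try by [].
- exact: ev_pos.
- apply: (ev_bin (o := Plus) (x := mxf K0 x) (y := v1 * v2)) => //.
  + apply: (ev_arr (n := x)); [exact: ev_pos | by nat_bound | | ].
      by rewrite /geta /= cutf_ge.
    by rewrite (mxf_divmod _ xQ).
  + apply: (ev_bin (o := Times) (x := v1) (y := v2)) => //; last by rewrite v12.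
      apply: ev_entry => //.
        by apply: ev_divn; [exact: ev_row | exact: ev_d | nat_bound].
      by apply: ev_divn; [exact: ev_col | exact: ev_d | nat_bound].
    apply: ev_entry => //.
      by apply: ev_modn; [exact: ev_row | exact: ev_d | nat_bound].
    by apply: ev_modn; [exact: ev_col | exact: ev_d | nat_bound].
  rewrite v12 (mxf_divmod _ xQ); by have := KB (hi X) (lo X); rewrite mxE.
- rewrite /s' /mk /seta /= /geta /= (cutf_step (f := mxf (K0 + kron1 M))) //.
  by rewrite !(mxf_divmod _ xQ) v12 mxE.
by nat_bound.
Qed.

Lemma run_shift f k D a0 (K0 T0 : 'M[int]_N) a3 w :
  (forall i j, (`|K0 i j| < 2 ^ B)%N) ->
  (forall i j, (`|(K0 - (m%:R)%:M)%R i j| < 2 ^ B)%N) ->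
  runs B shift_loop (mk f k D 0 0 0 a0 (mxf K0) (mxf T0) a3 w)
         (mk f k D 0 0 0 a0 (mxf (K0 - (m%:R)%:M)) (mxf (1%:M : 'M_N)) a3 w)
       (Q * 200 + 7).
Proof.
move=> K0B KB; set K := K0 - _ in KB *.
pose s j := mk f k D j 0 0 a0 (cutf j (mxf K) (mxf K0))
  (cutf j (mxf (1%:M : 'M_N)) (mxf T0)) a3 w.
pose s' j := mk f k D j 0 0 a0 (cutf j.+1 (mxf K) (mxf K0))
  (cutf j.+1 (mxf (1%:M : 'M_N)) (mxf T0)) a3 w.
apply: (@run_loop B B_ge8 7 4 _ s s' _ _ Q 195) => //; first by nat_bound.
  by rewrite /s !cutf_mxf.
move=> x xQ; pose X := Ordinal xQ.
have dE : (hi X == lo X)%:R = (x %/ N == x %% N)%N :> int by rewrite natz.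
have KE : K (hi X) (lo X) = K0 (hi X) (lo X) - m%:Z * (x %/ N == x %% N)%N.
  by rewrite !mxE -dE mulr_natr natz.
have mdB : (`|(m%:Z * (x %/ N == x %% N)%N)%R| < 2 ^ B)%N.
  by case: eqP => _; rewrite ?mulr1 ?mulr0 // expn_gt0.
apply: (runs_seq (s1 := mk f k D x 0 0 a0 (cutf x.+1 (mxf K) (mxf K0))
                         (cutf x (mxf (1%:M : 'M_N)) (mxf T0)) a3 w)
                 (T1 := 120) (T2 := 75)).
  apply: (run_store B_ge8 (n := x) (z := K (hi X) (lo X))); try by [].
  - exact: ev_pos.
  - rewrite KE; apply: ev_sub; last by rewrite -KE.
      apply: (ev_arr (n := x)); [exact: ev_pos | by nat_bound | | exact: K0B].
      by rewrite /geta /= cutf_ge (mxf_divmod _ xQ).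
    by apply: ev_mul => //; exact: ev_diag.
  - rewrite /mk /seta /= /geta /= (cutf_step (f := mxf K)) //.
    by rewrite (mxf_divmod _ xQ).
  by nat_bound.
apply: (run_store B_ge8 (n := x) (z := (x %/ N == x %% N)%N)); try by [].
- exact: ev_pos.
- exact: ev_diag.
- rewrite /s' /mk /seta /= /geta /= (cutf_step (f := mxf (1%:M : 'M_N))) //.
  by rewrite (mxf_divmod _ xQ) mxE -dE natz.
by nat_bound.
Qed.

Lemma run_mul f k D a0 (K T U0 : 'M[int]_N) (cK cT : nat) w :
  (forall i j, (`|K i j| <= cK)%N) -> (forall i j, (`|T i j| <= cT)%N) ->
  (cK < 2 ^ B)%N -> (cT < 2 ^ B)%N -> (N * (cK * cT) < 2 ^ B)%N ->
  runs B mul_loop (mk f k D 0 0 0 a0 (mxf K) (mxf T) (mxf U0) w)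
                  (mk f k D 0 0 0 a0 (mxf K) (mxf T) (mxf (K *m T)) w)
       (Q * (N * 105 + 112) + 7).
Proof.
move=> Kc Tc cKB cTB cB.
pose s j := mk f k D j 0 0 a0 (mxf K) (mxf T) (cutf j (mxf (K *m T)) (mxf U0)) w.
pose s' j := mk f k D j 0 0 a0 (mxf K) (mxf T) (cutf j.+1 (mxf (K *m T)) (mxf U0)) w.
have -> : (Q * (N * 105 + 112) + 7 = Q * ((N * (100 + 5) + 7 + 100) + 5) + 7)%N by lia.
apply: (@run_loop B B_ge8 7 4 _ s s' _ _ Q _) => //; first by nat_bound.
  by rewrite /s cutf_mxf.
move=> x xQ; have [rN cN] := (row_lt xQ, col_lt x); pose X := Ordinal xQ.
have mxfc (M : 'M[int]_N) c (Mc : forall i j, (`|M i j| <= c)%N) y : (`|mxf M y| <= c)%N.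
  exact: mxf_norm.
pose F l := mxf K (x %/ N * N + l) * mxf T (l * N + x %% N).
have Fc l : (`|F l| <= cK * cT)%N by rewrite abszM leq_mul // mxfc.
(* Every partial sum passes through the accumulator, so each of them has to be bounded. *)
pose dot j := \sum_(0 <= l < j) F l.
have dotB j : (j <= N)%N -> (`|dot j| < 2 ^ B)%N.
  move=> jN; apply: leq_ltn_trans (norm_sum_le j Fc) _.
  by apply: leq_ltn_trans cB; rewrite leq_mul2r jN orbT.
have dotE : dot N = (K *m T) (hi X) (lo X).
  rewrite /dot big_mkord mxE; apply: eq_bigr => l _; congr (_ * _).
    exact: (mxfE K (hi X) l).
  exact: (mxfE T l (lo X)).
pose a3 := cutf x (mxf (K *m T)) (mxf U0).
apply: (runs_seq (s1 := mk f k D x 0 (dot N) a0 (mxf K) (mxf T) a3 w)).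
  pose r l := mk f k D x l (dot l) a0 (mxf K) (mxf T) a3 w.
  pose r' l := mk f k D x l (dot l.+1) a0 (mxf K) (mxf T) a3 w.
  apply: (@run_loop B B_ge8 8 3 _ r r' _ _ N 100) => //; first by nat_bound.
    by rewrite /r /dot big_geq.
  move=> l lN.
  have el : ev B (r l) (Var 8) l by apply: ev_var => //=; nat_bound.
  have eN : ev B (r l) (Var 3) N by exact: ev_N.
  have eRow : ev B (r l) Row (x %/ N)%N by exact: ev_row.
  have eCol : ev B (r l) Col (x %% N)%N by exact: ev_col.
  have i1 : (x %/ N * N + l < Q)%N by nia.
  have i2 : (l * N + x %% N < Q)%N by nia.
  apply: (run_assign B_ge8 (z := dot l.+1)); try by [].
  apply: (ev_bin (o := Plus) (x := dot l) (y := F l)); last exact: dotB.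
  - by apply: ev_var => //; apply: dotB; apply: ltnW.
  - apply: ev_mul.
    + apply: (ev_arr (n := (x %/ N * N + l)%N)) => //; [| by nat_bound|].
        by apply: ev_addn (ev_muln eRow eN _) el _ => //; nat_bound.
      by apply: leq_ltn_trans cKB; apply: mxfc.
    + apply: (ev_arr (n := (l * N + x %% N)%N)) => //; [| by nat_bound|].
        by apply: ev_addn (ev_muln el eN _) eCol _ => //; nat_bound.
      by apply: leq_ltn_trans cTB; apply: mxfc.
    apply: leq_ltn_trans (Fc l) _; apply: leq_ltn_trans cB.
    by rewrite leq_pmull // muln_gt0 d_gt0.
  by rewrite /= /dot big_nat_recr.
apply: (runs_seq (s1 := mk f k D x 0 (dot N) a0 (mxf K) (mxf T)
                     (cutf x.+1 (mxf (K *m T)) (mxf U0)) w) (T1 := 60) (T2 := 40)).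
  apply: (run_store B_ge8 (n := x) (z := dot N)); try by [].
  - exact: ev_pos.
  - by apply: ev_var => //; apply: dotB.
  - rewrite /mk /seta /= /geta /= (cutf_step (f := mxf (K *m T))) //.
    by rewrite (mxf_divmod _ xQ) dotE.
  by nat_bound.
by apply: run_assign; [exact: B_ge8 | exact: ev_lit | reflexivity | by [] | by []].
Qed.

Lemma run_trace f k a0 a1 a2 (U : 'M[int]_N) (cU : nat) w :
  (forall i j, (`|U i j| <= cU)%N) -> (cU < 2 ^ B)%N -> (N * cU < 2 ^ B)%N ->
  runs B trace_loop (mk f k 0 0 0 0 a0 a1 a2 (mxf U) w)
                    (mk f k (- \tr U) 0 0 0 a0 a1 a2 (mxf U) w) (N * 100 + 7).
Proof.
move=> Uc cUB cB.
have Fc l : (`|(- mxf U (l * N + l))%R| <= cU)%N by rewrite abszN mxf_norm.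
pose t j := \sum_(0 <= l < j) (- mxf U (l * N + l)).
have tB j : (j <= N)%N -> (`|t j| < 2 ^ B)%N.
  move=> jN; apply: leq_ltn_trans (norm_sum_le j Fc) _.
  by apply: leq_ltn_trans cB; rewrite leq_mul2r jN orbT.
have tE : t N = - \tr U.
  by rewrite /t big_mkord /mxtrace -sumrN; apply: eq_bigr => i _; rewrite mxfE.
pose s j := mk f k (t j) j 0 0 a0 a1 a2 (mxf U) w.
pose s' j := mk f k (t j.+1) j 0 0 a0 a1 a2 (mxf U) w.
apply: (@run_loop B B_ge8 7 3 _ s s' _ _ N 95) => //; first by nat_bound.
- by rewrite /s /t big_geq.
- by rewrite -tE.
move=> l lN.
have el : ev B (s l) (Var 7) l by apply: ev_var => //=; nat_bound.
have i1 : (l * N + l < Q)%N by nia.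
apply: (run_assign B_ge8 (z := t l.+1)); try by [].
apply: (ev_bin (o := Minus) (x := t l) (y := mxf U (l * N + l))); last exact: tB.
- by apply: ev_var => //; apply: tB; apply: ltnW.
- apply: (ev_arr (n := (l * N + l)%N)) => //; [| by nat_bound|].
    apply: ev_addn (ev_muln el (ev_N _ _ _ _ _ _ _ _ _ _ _) _) el _ => //; by nat_bound.
  by apply: leq_ltn_trans cUB; apply: mxf_norm.
by rewrite /= /t big_nat_recr.
Qed.

Lemma run_update f k D a0 a1 (T0 U : 'M[int]_N) (cU : nat) w :
  (k < N)%N -> (forall i j, (`|U i j| <= cU)%N) -> (N * cU + `|D| < 2 ^ B)%N ->
  runs B update_loop (mk f k D 0 0 0 a0 a1 (mxf T0) (mxf U) w)
    (mk f k D 0 0 0 a0 a1 (mxf (k.+1%:R *: U + D%:M)) (mxf U) w) (Q * 200 + 7).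
Proof.
move=> kN Uc cB; set T := _ + _.
pose s j := mk f k D j 0 0 a0 a1 (cutf j (mxf T) (mxf T0)) (mxf U) w.
pose s' j := mk f k D j 0 0 a0 a1 (cutf j.+1 (mxf T) (mxf T0)) (mxf U) w.
apply: (@run_loop B B_ge8 7 4 _ s s' _ _ Q 195) => //; first by nat_bound.
  by rewrite /s cutf_mxf.
move=> x xQ; pose X := Ordinal xQ.
have dE : (hi X == lo X)%:R = (x %/ N == x %% N)%N :> int by rewrite natz.
have TE : T (hi X) (lo X) = k.+1%:Z * U (hi X) (lo X) + D * (x %/ N == x %% N)%N.
  by rewrite !mxE -dE mulr_natr natz.
have UX : (`|U (hi X) (lo X)| <= cU)%N by [].
have kU : (`|(k.+1%:Z * U (hi X) (lo X))%R| <= N * cU)%N by rewrite abszM leq_mul.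
have DX : (`|(D * (x %/ N == x %% N)%N)%R| <= `|D|)%N.
  by rewrite abszM; case: eqP => _; rewrite ?muln1 ?muln0.
have UB : (cU < 2 ^ B)%N.
  apply: leq_ltn_trans cB; apply: leq_trans (leq_addr _ _).
  by rewrite leq_pmull // muln_gt0 d_gt0.
apply: (run_store B_ge8 (n := x) (z := T (hi X) (lo X))); try by [].
- exact: ev_pos.
- rewrite TE; apply: ev_add; last by lia.
    apply: ev_mul; last by lia.
      have ek : ev B (s x) (Var 5) k by apply: ev_var => //=; nat_bound.
      have e1 : ev B (s x) (Lit 1) 1%N by [].
      by rewrite -[k.+1]addn1; apply: ev_addn ek e1 _; nat_bound.
    apply: (ev_arr (n := x)); [exact: ev_pos | by nat_bound | | by lia].
    by rewrite /geta /= (mxf_divmod _ xQ).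
  apply: ev_mul => //=; [| exact: ev_diag | by lia].
  by apply: ev_var => //=; lia.
- rewrite /s' /mk /seta /= /geta /= (cutf_step (f := mxf T)) //.
  by rewrite (mxf_divmod _ xQ).
by nat_bound.
Qed.

End Run.

(** * Size of the integers in the recurrence, and its main loop *)

Lemma absz_sum_le (I : Type) (r : seq I) (F : I -> int) (c : nat) :
  (forall i, (`|F i| <= c)%N) -> (`|(\sum_(i <- r) F i)%R| <= size r * c)%N.
Proof.
move=> Fc; elim: r => [|i r IH]; first by rewrite big_nil.
by rewrite big_cons /=; have := Fc i; move: (\sum_(_ <- _) _) IH; lia.
Qed.

Lemma absz_sum_ord n (F : 'I_n -> int) (c : nat) :
  (forall i, (`|F i| <= c)%N) -> (`|(\sum_i F i)%R| <= n * c)%N.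
Proof.
move=> /(absz_sum_le (index_enum 'I_n)).
by rewrite -[index_enum _]enumT size_enum_ord.
Qed.

Lemma absz_mulmx n (K T : 'M[int]_n) (cK cT : nat) :
  (forall i j, (`|K i j| <= cK)%N) -> (forall i j, (`|T i j| <= cT)%N) ->
  forall i j, (`|(K *m T) i j| <= n * (cK * cT))%N.
Proof.
move=> Kc Tc i j; rewrite mxE; apply: absz_sum_ord => l.
by rewrite abszM leq_mul.
Qed.

(** A step multiplies the bound by at most [2 * n * n * c]: one [n * n * c] from the product scaled
    by at most [n], another from the trace. *)
Lemma absz_fl_mx n (K : 'M[int]_n) (c k : nat) : (k <= n)%N ->
  (forall i j, (`|K i j| <= c)%N) ->
  forall i j, (`|fl_mx K k i j| <= (2 * n * n * c) ^ k)%N.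
Proof.
move=> kn Kc; elim: k kn => [|k IH] kn i j.
  by rewrite mxE; case: (i == j).
have := absz_mulmx Kc (IH (ltnW kn)); set M := K *m _; set t := (_ ^ k)%N => Mc.
have trM : (`|\tr M| <= n * (n * (c * t)))%N by apply: absz_sum_ord => l.
rewrite /= -/M; clearbody M; rewrite !mxE expnS -/t natz.
have h1 : (`|(k.+1%:Z * M i j)%R| <= n * (n * (c * t)))%N by rewrite abszM leq_mul.
have h2 : (`|(- \tr M *+ (i == j))%R| <= n * (n * (c * t)))%N.
  by case: (i == j); rewrite ?mulr1n ?mulr0n // abszN.
have -> : (2 * n * n * c * t = n * (n * (c * t)) + n * (n * (c * t)))%N by lia.
move: h1 h2; move: (_ * M i j) (_ *+ _) => x y; lia.
Qed.

(** The content of variable 0 after [k] passes; the program computes the conjunction as a product of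
    zeros and ones. *)
Fixpoint flag n (K : 'M[int]_n) k : bool :=
  if k is k'.+1 then flag K k' && (0 <= fl_coef K k') else true.

Lemma flagP n (K : 'M[int]_n) k :
  flag K k <-> forall i, (i < k)%N -> 0 <= fl_coef K i.
Proof.
elim: k => [|k IH] //=; split=> [/andP[/IH h hk] i|h].
  by rewrite ltnS leq_eqVlt => /orP[/eqP ->|/h].
by apply/andP; split; [apply/IH => i ik; apply: h; apply: ltnW | apply: h].
Qed.

Section Steps.

Variables (d m B : nat).
Hypothesis B_ge8 : (8 <= B)%N.
Hypothesis d_gt0 : (0 < d)%N.

Local Notation N := (d * d)%N.
Local Notation Q := (N * N)%N.

Hypothesis QB : (8 * Q + 8 < 2 ^ B)%N.
Hypothesis mB : (m < 2 ^ B)%N.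

Variables (K : 'M[int]_N) (c : nat).
Hypothesis c_gt0 : (0 < c)%N.
Hypothesis Kc : forall i j, (`|K i j| <= c)%N.

(** [tau] bounds the entries of the [fl_mx], and [W] the traces of their products with [K]. The
    square in [WB] makes room for the one formed by [Nonneg]. *)
Let tau := ((2 * N * N * c) ^ N)%N.
Let W := (N * (N * (c * tau)))%N.

Hypothesis WB : ((W + 1) ^ 2 < 2 ^ B)%N.

(** What the previous pass has left in array 3. *)
Definition prevU k : 'M[int]_N := if k is k'.+1 then K *m fl_mx K k' else 0.

Lemma run_fl_step k a0 w : (k < N)%N ->
  runs B fl_step
    (mk d m (flag K k) k 0 0 0 0 a0 (mxf K) (mxf (fl_mx K k)) (mxf (prevU k)) w)
    (mk d m (flag K k.+1) k 0 0 0 0 a0 (mxf K) (mxf (fl_mx K k.+1)) (mxf (prevU k.+1)) w)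
    ((Q * (N * 105 + 112) + 7) + ((N * 100 + 7) + ((Q * 200 + 7) + 100))).
Proof.
move=> kN; have N_gt0 : (0 < N)%N by rewrite muln_gt0 d_gt0.
have tau0 : (0 < tau)%N by rewrite expn_gt0 !muln_gt0 d_gt0 c_gt0.
have Tc i j : (`|fl_mx K k i j| <= tau)%N.
  apply: leq_trans (absz_fl_mx (ltnW kN) Kc i j) _.
  by rewrite leq_pexp2l ?(ltnW kN) // !muln_gt0 d_gt0 c_gt0.
have W1 : (c * tau <= N * (c * tau))%N by rewrite leq_pmull.
have W2 : (N * (c * tau) <= W)%N by rewrite leq_pmull.
have W3 : (c <= c * tau)%N by rewrite leq_pmulr.
have W4 : (tau <= c * tau)%N by rewrite leq_pmull.
have W5 : (2 * W + 1 + W ^ 2 < 2 ^ B)%N by move: WB; rewrite sqrnD; lia.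
have Uc := absz_mulmx Kc Tc; set U := K *m fl_mx K k in Uc.
have Dc : (`|fl_coef K k| <= W)%N.
  by rewrite /fl_coef abszN; apply: absz_sum_ord => l.
have D2 : (`|fl_coef K k| ^ 2 <= W ^ 2)%N by rewrite leq_exp2r.
apply: runs_seq.
  apply: (run_mul B_ge8 d_gt0 QB mB (cK := c) (cT := tau)) => //; lia.
apply: runs_seq.
  apply: (run_trace B_ge8 d_gt0 QB mB (cU := (N * (c * tau))%N)) => //; first lia.
  by rewrite -/W; lia.
apply: runs_seq.
  apply: (run_update B_ge8 d_gt0 QB mB (cU := (N * (c * tau))%N)) => //.
  rewrite -/W -/(fl_coef K k); lia.
have fB (b : bool) : (b < 2 ^ B)%N by case: b; lia.
apply: (runs_seq (T1 := 70) (T2 := 30)).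
  apply: (run_assign B_ge8 (z := (flag K k.+1 : nat))); try by [].
  rewrite /= -mulnb; apply: ev_muln.
  - by apply: ev_var => //; apply: fB.
  - apply: ev_nonneg; first by apply: ev_var => //=; rewrite -/(fl_coef K k); lia.
    by rewrite -/(fl_coef K k); lia.
  by rewrite mulnb.
by apply: run_assign; [exact: B_ge8 | exact: ev_lit | | by [] | by []].
Qed.

Lemma run_main a0 w :
  runs B (Loop 5 3 fl_step)
    (mk d m 1 0 0 0 0 0 a0 (mxf K) (mxf (1%:M : 'M_N)) (mxf (0 : 'M_N)) w)
    (mk d m (flag K N) 0 0 0 0 0 a0 (mxf K) (mxf (fl_mx K N)) (mxf (prevU N)) w)
    (N * ((Q * (N * 105 + 112) + 7) + ((N * 100 + 7) + ((Q * 200 + 7) + 100)) + 5) + 7).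
Proof.
pose s k := mk d m (flag K k) k 0 0 0 0 a0
  (mxf K) (mxf (fl_mx K k)) (mxf (prevU k)) w.
pose s' k := mk d m (flag K k.+1) k 0 0 0 0 a0
  (mxf K) (mxf (fl_mx K k.+1)) (mxf (prevU k.+1)) w.
apply: (@run_loop B B_ge8 5 3 _ s s' _ _ N _) => //.
  by have := leNQ d_gt0; lia.
by move=> k kN; apply: run_fl_step.
Qed.

End Steps.

(** * The whole program, and bounds in terms of the input size *)

Section Decide.

Variables (d m : nat) (A : 'I_m -> 'M[int]_d).
Hypotheses (d_gt0 : (0 < d)%N) (m_gt0 : (0 < m)%N).

Local Notation N := (d * d)%N.
Local Notation Q := (N * N)%N.
Local Notation s := (input_size A).

Lemma mem_encode_le z : z \in encode A -> (bitlen z <= s)%N.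
Proof. by move=> zA; rewrite /input_size (big_rem z zA) leq_addr. Qed.

Lemma abs_encode_lt z : z \in encode A -> (`|z| < 2 ^ s)%N.
Proof.
move=> /mem_encode_le zs; apply: leq_trans (_ : 2 ^ bitlen z <= _)%N.
  by rewrite /bitlen trunc_log_ltn.
by rewrite leq_exp2l.
Qed.

Lemma entry_lt k i j : (`|A k i j| < 2 ^ s)%N.
Proof.
apply: abs_encode_lt; rewrite !inE; do 2! (apply/orP; right).
apply/flattenP; exists (mxseq (A k)); last first.
  by apply/allpairsP; exists (i, j); rewrite !mem_enum.
by apply: map_f; rewrite mem_enum.
Qed.

Lemma size_encode : size (encode A) = (m * N).+2.
Proof.
rewrite /= size_flatten /shape -map_comp (eq_map (g := fun=> N)).
  by rewrite sumnE big_map big_const_seq count_predT size_enum_ord iter_addn_0 mulnC.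
by move=> k; rewrite /= size_mxseq.
Qed.

(** Every integer of the input counts for at least one bit. This makes [N] and [m * N], hence the
    numbers of iterations, polynomial in the input size. *)
Lemma input_size_ge : ((m * N).+2 <= s)%N.
Proof.
rewrite -size_encode -sum1_size /input_size; apply: leq_sum => z _.
by rewrite /bitlen.
Qed.

Definition mats := [seq A k | k <- enum 'I_m].

Lemma size_mats : size mats = m.
Proof. by rewrite size_map size_enum_ord. Qed.

Definition mat l : 'M[int]_d := nth 0 mats l.

Definition kron_prefix j : 'M[int]_N := \sum_(0 <= i < j) kron1 (mat i).

Lemma kron_prefix_all : kron_prefix m = kron A.
Proof.
apply/matrixP => p q; rewrite /kron_prefix big_mkord summxE mxE.
apply: eq_bigr => k _; rewrite mxE.
by rewrite /mat /mats (nth_map k) ?size_enum_ord // nth_ord_enum.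
Qed.

Lemma mat_lt l i j : (`|mat l i j| < 2 ^ s)%N.
Proof.
case: (ltnP l m) => [lm|ml]; last first.
  by rewrite /mat nth_default ?size_mats // mxE expn_gt0.
by rewrite /mat /mats (nth_map (Ordinal lm)) ?size_enum_ord // entry_lt.
Qed.

Let E := (2 ^ s)%N.

Lemma kron1_le l p q : (`|kron1 (mat l) p q| <= E * E)%N.
Proof. by rewrite mxE abszM leq_mul // ltnW // mat_lt. Qed.

Lemma kron_prefix_le j p q : (j <= m)%N -> (`|kron_prefix j p q| <= m * (E * E))%N.
Proof.
move=> jm; rewrite summxE.
apply: leq_trans (norm_sum_le j (fun l => kron1_le l p q)) _.
by rewrite leq_mul2r jm orbT.
Qed.

(** The largest numbers are at most [E ^ (14 * s + 14) = 2 ^ (14 * s * s + 14 * s)]; the 8 makes the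
    inequality strict and ensures [8 <= B]. *)
Let B := (14 * s * s + 14 * s + 8)%N.

Lemma size_facts : [/\ (m < E)%N, (N < E)%N, (0 < N)%N, (2 <= E)%N & (2 <= s)%N].
Proof.
have := input_size_ge; have sE : (s < E)%N by apply: ltn_expl.
have N0 : (0 < N)%N by rewrite muln_gt0 d_gt0.
have : (m <= m * N)%N by rewrite leq_pmulr.
have : (N <= m * N)%N by rewrite leq_pmull.
by move=> *; split=> //; lia.
Qed.

Lemma pow_bound e : (e <= 14 * s + 14)%N -> (E ^ e < 2 ^ B)%N.
Proof.
move=> e14; rewrite /E -expnM ltn_exp2l // /B.
have : (s * e <= s * (14 * s + 14))%N by rewrite leq_mul2l e14 orbT.
lia.
Qed.

Lemma test_mx_le p q : (`|test_mx A p q| <= 2 * E ^ 3)%N.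
Proof.
have [mE _ _ E2 _] := size_facts.
rewrite /test_mx -kron_prefix_all mxE [X in `|(_ + X)%R|%N]mxE [X in `|(_ - X)%R|%N]mxE.
have := kron_prefix_le p q (leqnn m).
have h : (`|((m%:R : int) *+ (p == q))%R| <= m)%N.
  by rewrite natz; case: (p == q).
move: (kron_prefix m p q) (_ *+ _) h => x y hy hx.
have : (m * (E * E) <= E ^ 3)%N by rewrite !expnS expn0 muln1 leq_mul2r ltnW ?orbT.
have : (m <= E ^ 3)%N by rewrite (leq_trans (ltnW mE)) // -{1}[E]expn1 leq_pexp2l // ltnW.
lia.
Qed.

(** The base of the power is at most [E ^ 7] and the exponent [N] at most [s]. The remaining factors
    cost at most [E ^ 7] more, and squaring yields the exponent [14 * s + 14]. *)
Lemma work_bound (tau := ((2 * N * N * (2 * E ^ 3)) ^ N)%N) :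
  ((N * (N * (2 * E ^ 3 * tau)) + 1) ^ 2 < 2 ^ B)%N.
Proof.
have [mE NE N0 E2 s2] := size_facts.
have E0 : (0 < E)%N by lia.
have Ns : (N <= s)%N.
  have := input_size_ge; have : (N <= m * N)%N by rewrite leq_pmull.
  lia.
have NN : (N * N <= E * E)%N by rewrite leq_mul // ltnW.
have b1 : (2 * N * N * (2 * E ^ 3) <= E ^ 7)%N.
  have -> : (2 * N * N * (2 * E ^ 3) = (2 * 2) * (N * N) * E ^ 3)%N by lia.
  have -> : (E ^ 7 = (E * E) * (E * E) * E ^ 3)%N by rewrite !expnS expn0; lia.
  by rewrite leq_mul2r; apply/orP; right; rewrite leq_mul // leq_mul.
have b2 : (tau <= E ^ (7 * s))%N.
  rewrite expnM; apply: leq_trans (_ : (E ^ 7) ^ N <= _)%N.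
    by rewrite leq_exp2r.
  by rewrite leq_pexp2l // expn_gt0 E0.
have b3 : (N * (N * (2 * E ^ 3 * tau)) <= E ^ (7 * s + 6))%N.
  have -> : (N * (N * (2 * E ^ 3 * tau)) = (2 * (N * N) * E ^ 3) * tau)%N by lia.
  rewrite expnD [X in (_ <= X)%N]mulnC leq_mul //.
  have -> : (E ^ 6 = E * (E * E) * E ^ 3)%N by rewrite !expnS expn0; lia.
  by rewrite leq_mul2r; apply/orP; right; rewrite leq_mul.
have b4 : (N * (N * (2 * E ^ 3 * tau)) + 1 <= E ^ (7 * s + 7))%N.
  have : (0 < E ^ (7 * s + 6))%N by rewrite expn_gt0 E0.
  have -> : (E ^ (7 * s + 7) = E * E ^ (7 * s + 6))%N by rewrite -expnS -addnS.
  move: b3; move: (E ^ (7 * s + 6))%N (N * (N * (2 * E ^ 3 * tau)))%N => P a aP P0.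
  have : (2 * P <= E * P)%N by rewrite leq_mul2r E2 orbT.
  by lia.
apply: leq_ltn_trans (_ : (E ^ (7 * s + 7)) ^ 2 < _)%N.
  by rewrite leq_exp2r.
by rewrite -expnM; apply: pow_bound; lia.
Qed.

(** The matrix left in array 0 after [j] have been read. *)
Definition prevA j : 'M[int]_d := if j is j'.+1 then mat j' else 0.

Lemma run_decide : exists2 s1 : state,
  runs B decide (St (nseq 10 0) (nseq 4 (fun=> 0)) (encode A)) s1 (1300 * s ^ 4)
  & getv s1 0 = flag (test_mx A) N.
Proof.
have [mE NE N0 E2 s2] := size_facts.
have B8 : (8 <= B)%N by rewrite leq_addl.
have EB1 := @pow_bound 1 ltac:(lia); have EB2 := @pow_bound 2 ltac:(lia).
have EB4 := @pow_bound 4 ltac:(lia); have EB6 := @pow_bound 6 ltac:(lia).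
rewrite expn1 in EB1.
have QB : (8 * Q + 8 < 2 ^ B)%N.
  apply: leq_ltn_trans EB6; have : (Q <= E * E)%N by rewrite leq_mul // ltnW.
  have : (2 ^ 4 <= E ^ 4)%N by rewrite leq_exp2r.
  have -> : (E ^ 6 = E * E * E ^ 4)%N by rewrite !expnS expn0; lia.
  have : (1 <= E * E)%N by lia.
  nia.
have mB : (m < 2 ^ B)%N by apply: ltn_trans EB1.
have dE : (d <= N)%N by rewrite leq_pmulr.
have dB : (d < 2 ^ B)%N by lia.
have E3 : (m * (E * E) <= E ^ 3)%N by rewrite !expnS expn0 muln1 leq_mul2r ltnW ?orbT.
have E34 : (2 * E ^ 3 <= E ^ 4)%N by rewrite [(E ^ 4)%N]expnS leq_mul2r E2 orbT.
have prefB j p q : (j <= m)%N -> (`|kron_prefix j p q| < 2 ^ B)%N.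
  by move=> jm; have := kron_prefix_le p q jm; lia.
have kB p q : (`|test_mx A p q| < 2 ^ B)%N by have := test_mx_le p q; lia.
pose z0 : nat -> int := fun=> 0; pose O : 'M[int]_N := 0.
pose st f (M : 'M[int]_d) j (K T : 'M[int]_N) w :=
  mk d m f j 0 0 0 0 (mxf M) (mxf K) (mxf T) (mxf O) w.
pose tp j := flatten [seq mxseq M | M <- drop j mats].
exists (mk d m (flag (test_mx A) N) 0 0 0 0 0 (mxf (prevA m)) (mxf (test_mx A))
    (mxf (fl_mx (test_mx A) N)) (mxf (prevU (test_mx A) N)) (tp m)) => //.
pose T1 := ((m * (((N * 100 + 7) + (Q * 200 + 7)) + 5) + 7))%N.
pose T2 := (Q * 200 + 7)%N.
pose T3 := (N * (((Q * (N * 105 + 112) + 7) +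
                  ((N * 100 + 7) + ((Q * 200 + 7) + 100))) + 5) + 7)%N.
apply: (@runs_le _ _ _ _ (1 + (1 + (50 + (50 + (T1 + (T2 + (50 + T3)))))))%N).
  (* All terms are bounded by multiples of [s ^ 4] through [N <= s] and [m * N <= s]; the dominant
     one is [N ^ 4], from the [N] matrix products. *)
  have := input_size_ge; rewrite /T1 /T2 /T3; move: N N0 (s) s2 => n n0 x x2 mnx.
  have mn : (m <= m * n)%N by rewrite leq_pmulr.
  have nx : (n <= x)%N by have : (n <= m * n)%N by [rewrite leq_pmull]; lia.
  have x2E : (x <= x * x)%N by rewrite leq_pmull //; lia.
  have n2 : (n * n <= x * x)%N by rewrite leq_mul.
  have mn2 : (m * n * n <= x * x)%N by rewrite leq_mul //; lia.
  have n3 : (n * n * n <= x * x * x)%N by rewrite leq_mul.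
  have n4 : (n * n * n * n <= x * x * x * x)%N by rewrite leq_mul.
  have x23 : (x * x <= x * x * x)%N by rewrite leq_pmulr //; lia.
  have x34 : (x * x * x <= x * x * x * x)%N by rewrite leq_pmulr //; lia.
  have -> : (x ^ 4 = x * x * x * x)%N by rewrite !expnS expn0; lia.
  lia.
apply: (runs_seq (s1 := St [:: 0; d%:Z; 0; 0; 0; 0; 0; 0; 0; 0] (nseq 4 z0)
                               (m%:Z :: tp 0%N))).
  apply: (run_input B8 (z := d%:Z)) => //.
  by rewrite /tp drop0 /mats -map_comp.
apply: (runs_seq (s1 := St [:: 0; d%:Z; m%:Z; 0; 0; 0; 0; 0; 0; 0] (nseq 4 z0)
                               (tp 0%N))).
  exact: (run_input B8 (z := m%:Z)).
apply: (runs_seq (s1 := St [:: 0; d%:Z; m%:Z; N%:Z; 0; 0; 0; 0; 0; 0] (nseq 4 z0)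
                               (tp 0%N))).
  apply: (run_assign B8 (z := N%:Z)) => //.
  by apply: ev_muln; [exact: ev_var | exact: ev_var | lia].
apply: (runs_seq (s1 := st 0%N (prevA 0) 0%N (kron_prefix 0) O (tp 0%N))).
  apply: (run_assign B8 (z := Q%:Z)) => //.
    have NB : (N < 2 ^ B)%N by lia.
    by apply: ev_muln; [exact: ev_var | exact: ev_var | lia].
  by rewrite /st /O /kron_prefix big_geq // !mxf0.
apply: (runs_seq (s1 := st 0%N (prevA m) 0%N (kron_prefix m) O (tp m))).
  pose r j := st 0%N (prevA j) j (kron_prefix j) O (tp j).
  pose r' j := st 0%N (prevA j.+1) j (kron_prefix j.+1) O (tp j.+1).
  apply: (@run_loop B B8 5 2 _ r r' _ _ m _) => //.
  move=> j jm; rewrite /r /st.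
  have -> : tp j = mxseq (mat j) ++ tp j.+1.
    by rewrite /tp (drop_nth 0) ?size_mats.
  apply: runs_seq.
    apply: (run_read B8 d_gt0 QB mB (M := mat j)) => a b.
    exact: ltn_trans (mat_lt j a b) EB1.
  have kS : kron_prefix j.+1 = kron_prefix j + kron1 (mat j).
    by rewrite /kron_prefix big_nat_recr.
  rewrite /r' kS; apply: (run_kron B8 d_gt0 QB mB).
  - by move=> a b; apply: ltn_trans (mat_lt j a b) EB1.
  - by move=> a b; apply: prefB; apply: ltnW.
  - by move=> a b; apply: leq_ltn_trans (kron1_le j a b) _; rewrite mulnn.
  by move=> a b; rewrite -kS; apply: prefB.
rewrite kron_prefix_all.
apply: (runs_seq (s1 := st 0%N (prevA m) 0%N (test_mx A) 1%:M (tp m))).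
  apply: (run_shift B8 d_gt0 QB mB) => [a b|]; last exact: kB.
  by rewrite -kron_prefix_all; apply: prefB.
apply: (runs_seq (s1 := st 1%N (prevA m) 0%N (test_mx A) 1%:M (tp m))).
  by apply: (run_assign B8 (z := 1)).
apply: (run_main B8 d_gt0 QB mB (c := (2 * E ^ 3)%N)).
- by rewrite muln_gt0 expn_gt0 (leq_trans _ E2).
- exact: test_mx_le.
exact: work_bound.
Qed.

End Decide.

Lemma rep_initial w : rep (St (nseq 10 0) (nseq 4 (fun=> 0)) w) (fun=> 0) w.
Proof.
split=> // [x|a i _].
  by rewrite /getv nth_nseq; case: ifP.
by rewrite /geta nth_nseq; case: ifP.
Qed.

Theorem theorem9 (R : realType) :
  exists (P : program) (p : {poly nat}),
    forall (d m : nat) (A : 'I_m -> 'M[int]_d),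
      (0 < d)%N -> (0 < m)%N ->
      exists (t : nat) (b : bool),
        [/\ halts P (initial (encode A)) t b,
            (t <= p.[input_size A])%N
          & irreducible A R -> non_mortal A ->
            (b <-> finite_set (generated_semigroup A))].
Proof.
(* At most [1300 * s ^ 4] instructions, each of cost at most [5 * B <= 180 * s ^ 2]; raising 180 to
   181 pays for the final halt. *)
exists (compile 0 decide), ((1300 * 181)%N *: 'X^6) => d m A d0 m0.
have [s1 run1 flag1] := run_decide A d0 m0.
have codeP : code_at (compile 0 decide) 0 (compile 0 decide) by [].
have [M' [w' [t [ht [hv _ _] tB]]]] :=
  run1 (compile 0 decide) 0%N _ _ codeP (rep_initial (encode A)).
exists (t + 1)%N, (flag (test_mx A) (d * d)); split.
- have := reach_halts ht; rewrite add0n => hh.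
  (* Register 0 is [var 0], which holds the answer. *)
  have <- : Defs.mem (Config (size (compile 0 decide)) M' w') 0%N != 0
            = flag (test_mx A) (d * d).
    by have := hv 0%N; rewrite flag1 /= => ->; case: (flag _ _).
  (* The program halts by running past its last instruction. *)
  by apply: hh; rewrite /fetch nth_default.
- have := input_size_ge A; move: tB; move: (input_size A) => s tB s0.
  rewrite hornerZ hornerXn natrXE.
  have B6 : (5 * (14 * s * s + 14 * s + 8) <= 180 * s ^ 2)%N.
    by rewrite -mulnn; nia.
  have h1 : (t <= 1300 * 180 * s ^ 6)%N.
    have -> : (s ^ 6 = s ^ 4 * s ^ 2)%N by rewrite -expnD.
    apply: leq_trans tB _.
    by apply: leq_trans (leq_mul (leqnn _) B6) _; rewrite mulnACA.
  have h2 : (1 <= s ^ 6)%N by rewrite expn_gt0; lia.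
  move: (s ^ 6)%N h1 h2 => x h1 h2; lia.
move=> irrA nmA.
have iffA := finite_semigroup_fl_coef d0 m0 irrA nmA.
split=> [/flagP h|finA]; first exact/iffA.
by apply/flagP/iffA.
Qed.
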